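(* Let $\mathcal{M}$ be a geodesically complete, stochastically complete, connected Riemannian manifold with bounded sectional curvature, with geodesic distance $d$ and minimal heat kernel $p$. Let $X:\Omega\to\mathcal{M}$ be a random variable on $\mathcal{M}$ and fix $t>0$. The diffusion estimator $E_{t,n}$ is strongly consistent in the sense of Bhattacharya and Patrangenaru, i.e. $E_t(X)\ne\emptyset$ and for every $\varepsilon>0$ and almost all $\omega$ there is a number $n=n(\varepsilon,\omega)>0$ such that $$\bigcup_{k=n}^\infty E_{t,k}(\omega)\subset B(E_t(X),\varepsilon),$$ if $E_t(X)\neq\emptyset$ and the following conditions hold: 1. $E_{t,n}$ is strongly consistent in the sense of Ziezold, i.e. for almost all $\omega$, $\bigcap_{n=1}^\infty\overline{\bigcup_{k=n}^\infty E_{t,k}(\omega)}\subset E_t(X)$. 2. Almost surely, every closed bounded subset of $\overline{\bigcup_{n=1}^\infty E_{t,n}}$ is compact (the Heine-Borel property). 3. There exist $y_0\in\mathcal{M}$ and $C>0$ such that $\mathbb{P}(-\ln p(X,y_0,t)<C)>0$ and for every sequence $y_n\in\mathcal{M}$ with $d(y_0,y_n)\to\infty$ there is a sequence $R_{t,n}\to\infty$ with $-\ln p(x,y_n,t)>R_{t,n}$ for all $x\in\mathcal{M}$ with $-\ln p(x,y_0,t)<C$.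
   Context: $p(x,y,t)$ is the minimal heat kernel of $\mathcal{M}$: the minimal solution of $\frac{d}{dt}u(x,y,t)=\frac12\Delta_x u(x,y,t)$ with $\int_{\mathcal{M}}p(x,y,t)\,dy=1$ for all $x\in\mathcal{M}$, $t>0$ (stochastic completeness is the existence of such $p$; bounded sectional curvature ensures $p(\cdot,\cdot,t)$ is bounded for each $t>0$). The diffusion $t$-mean set is $E_t(X)=\operatorname{argmin}_{y\in\mathcal{M}}\mathbb{E}[-\ln p(X,y,t)]$. For i.i.d. samples $X_1,X_2,\dots\sim X$, the diffusion estimator is the collection of random closed sets $E_{t,n}=\operatorname{argmin}_{y\in\mathcal{M}}\big(-\frac1n\sum_{i=1}^n\ln p(X_i,y,t)\big)$. $B(E,\varepsilon)$ is the union of balls of radius $\varepsilon$ around all points of $E$. *)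

(* Defs.v *)
(* MathComp / MathComp-Analysis *)
From HB Require Import structures.
From mathcomp Require Import all_boot all_order all_algebra.
From mathcomp Require Import all_classical all_reals all_analysis.

Set Implicit Arguments.
Unset Strict Implicit.
Unset Printing Implicit Defensive.

Import Order.TTheory GRing.Theory Num.Theory.
Import numFieldNormedType.Exports.

Local Open Scope classical_set_scope.
Local Open Scope ring_scope.

Section Euclidean.
Variables (R : realType) (n : nat).

(* Partial derivatives are taken along lines [t |-> v + t e_a], so that they
   make sense for every n, including n = 0 (where 'rV[R]_n is not an instance
   of the library's normed modules). *)
Definition coordinate_line (a : 'I_n) (f : 'rV[R]_n -> R) (v : 'rV[R]_n) :
  R -> R := fun t => f (v + t *: delta_mx 0 a).

Definition partial (a : 'I_n) (f : 'rV[R]_n -> R) (v : 'rV[R]_n) : R :=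
  derive1 (coordinate_line a f v) 0.

Definition partials (s : seq 'I_n) (f : 'rV[R]_n -> R) : 'rV[R]_n -> R :=
  foldr partial f s.

(* Meant for open [A]: off [A] the iterated partials may be junk values. *)
Definition Ck_on (k : nat) (A : set 'rV[R]_n) (f : 'rV[R]_n -> R) : Prop :=
  forall s : seq 'I_n, (size s <= k)%N -> forall v, A v ->
    {for v, continuous (partials s f)} /\
    ((size s < k)%N ->
      forall a, derivable (coordinate_line a (partials s f) v) 0 1).

Definition smooth_on (A : set 'rV[R]_n) (f : 'rV[R]_n -> R) : Prop :=
  forall k, Ck_on k A f.

End Euclidean.

(* The integral over R^n of a nonnegative Borel function, as an iterated
   integral (by Tonelli, this is integration against n-dimensional Lebesgue
   measure, which the library does not provide). *)
Fixpoint lebesgue_iter (R : realType) (n : nat) :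
    ('rV[R]_n -> \bar R) -> \bar R :=
  match n return ('rV[R]_n -> \bar R) -> \bar R with
  | 0%N => fun f => f 0
  | m.+1 => fun f =>
      (\int[lebesgue_measure]_(t in [set: R])
        lebesgue_iter (fun v : 'rV[R]_m =>
          f (row_mx (t%:M : 'M[R]_1) v : 'rV[R]_(1 + m))))%E
  end.

(* [psi i] is the inverse of the chart [phi i : dom i -> R^n]; [chart_at x] is
   a chart around [x], used to evaluate objects that do not depend on the
   choice of a chart. *)
Record smooth_atlas (R : realType) (n : nat) (M : topologicalType) :=
  SmoothAtlas {
    chart : Type;
    dom : chart -> set M;
    phi : chart -> M -> 'rV[R]_n;
    psi : chart -> 'rV[R]_n -> M;
    chart_at : M -> chart;
    dom_open : forall i, open (dom i);
    cod_open : forall i, open (phi i @` dom i);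
    phi_continuous : forall i x, dom i x -> {for x, continuous (phi i)};
    psi_continuous : forall i v, (phi i @` dom i) v ->
      {for v, continuous (psi i)};
    phiK : forall i x, dom i x -> psi i (phi i x) = x;
    dom_chart_at : forall x, dom (chart_at x) x;
    transition_smooth : forall i j (b : 'I_n),
      smooth_on (phi i @` (dom i `&` dom j)) (fun v => phi j (psi i v) 0 b)
  }.

Definition cod (R : realType) (n : nat) (M : topologicalType)
    (A : smooth_atlas R n M) (i : chart A) : set 'rV[R]_n :=
  phi i @` dom i.

Definition transition_jacobian (R : realType) (n : nat) (M : topologicalType)
    (A : smooth_atlas R n M) (i j : chart A) (v : 'rV[R]_n) : 'M[R]_n :=
  \matrix_(a, b) partial a (fun w => phi j (psi i w) 0 b) v.

(* [gram i v] is the matrix of the coefficients g_ab in the chart [i], at the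
   point of coordinates [v]. *)
Record riemannian_metric (R : realType) (n : nat) (M : topologicalType)
    (A : smooth_atlas R n M) := RiemannianMetric {
  gram : chart A -> 'rV[R]_n -> 'M[R]_n;
  gram_smooth : forall i a b, smooth_on (cod i) (fun v => gram i v a b);
  gram_sym : forall i v, cod i v -> (gram i v)^T = gram i v;
  gram_pos : forall i v, cod i v -> forall u : 'rV[R]_n, u != 0 ->
    0 < (u *m gram i v *m u^T) 0 0;
  gram_compat : forall i j x, dom i x -> dom j x ->
    let J := transition_jacobian i j (phi i x) in
    gram i (phi i x) = J *m gram j (phi j x) *m J^T
}.

Section RiemannianGeometry.
Variables (R : realType) (n : nat) (M : topologicalType).
Variables (A : smooth_atlas R n M) (g : riemannian_metric A).

Definition gdot (i : chart A) (v u w : 'rV[R]_n) : R :=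
  (u *m gram g i v *m w^T) 0 0.

Definition ginv (i : chart A) (v : 'rV[R]_n) : 'M[R]_n := invmx (gram g i v).

Definition sqrt_det (i : chart A) (v : 'rV[R]_n) : R :=
  Num.sqrt (\det (gram g i v)).

(* Christoffel symbol Gamma^c_{ab} of the Levi-Civita connection *)
Definition christoffel (i : chart A) (c a b : 'I_n) (v : 'rV[R]_n) : R :=
  2^-1 * \sum_(l < n) ginv i v c l *
    (partial a (fun w => gram g i w b l) v
     + partial b (fun w => gram g i w a l) v
     - partial l (fun w => gram g i w a b) v).

(* R(e_a, e_b) e_c = \sum_l (riemann i l a b c) e_l *)
Definition riemann (i : chart A) (l a b c : 'I_n) (v : 'rV[R]_n) : R :=
  partial a (christoffel i l b c) v - partial b (christoffel i l a c) v
  + \sum_(m < n) (christoffel i l a m v * christoffel i m b c v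
                  - christoffel i l b m v * christoffel i m a c v).

Definition curvature_operator (i : chart A) (v u w z : 'rV[R]_n) : 'rV[R]_n :=
  \row_l \sum_(a < n) \sum_(b < n) \sum_(c < n)
    riemann i l a b c v * u 0 a * w 0 b * z 0 c.

(* sectional curvature of the plane spanned by [u] and [w] *)
Definition sectional_curvature (i : chart A) (v u w : 'rV[R]_n) : R :=
  gdot i v (curvature_operator i v u w w) u
  / (gdot i v u u * gdot i v w w - gdot i v u w ^+ 2).

Definition bounded_sectional_curvature : Prop :=
  exists K : R, forall (i : chart A) (x : M), dom i x ->
    forall u w : 'rV[R]_n, row_free (col_mx u w) ->
      `|sectional_curvature i (phi i x) u w| <= K.

Definition coord (i : chart A) (gamma : R -> M) (a : 'I_n) : R -> R :=
  fun t => phi i (gamma t) 0 a.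

Definition velocity (i : chart A) (gamma : R -> M) (t : R) : 'rV[R]_n :=
  \row_a derive1 (coord i gamma a) t.

Definition geodesic (gamma : R -> M) : Prop :=
  continuous gamma /\
  forall (t : R) (i : chart A), dom i (gamma t) -> forall c : 'I_n,
    [/\ \forall s \near t, derivable (coord i gamma c) s 1,
        derivable (derive1 (coord i gamma c)) t 1 &
        derive1 (derive1 (coord i gamma c)) t
        + \sum_(a < n) \sum_(b < n) christoffel i c a b (phi i (gamma t))
            * derive1 (coord i gamma a) t * derive1 (coord i gamma b) t = 0].

(* every initial point and velocity is realized by a geodesic defined on R *)
Definition geodesically_complete : Prop :=
  forall (i : chart A) (x : M) (u : 'rV[R]_n), dom i x ->
    exists gamma : R -> M,
      [/\ geodesic gamma, gamma 0 = x & velocity i gamma 0 = u].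

Definition C1_at (gamma : R -> M) (t : R) : Prop :=
  {for t, continuous gamma} /\
  forall i : chart A, dom i (gamma t) -> forall a : 'I_n,
    (\forall s \near t, derivable (coord i gamma a) s 1) /\
    {for t, continuous (derive1 (coord i gamma a))}.

(* C^1 curves on [0, 1] up to the end points: such a curve always extends to
   a curve that is C^1 on a neighbourhood of [0, 1]. *)
Definition C1_curve (gamma : R -> M) : Prop :=
  forall t, 0 <= t <= 1 -> C1_at gamma t.

Definition speed (gamma : R -> M) (t : R) : R :=
  let i := chart_at A (gamma t) in
  let u := velocity i gamma t in
  Num.sqrt (gdot i (phi i (gamma t)) u u).

Definition curve_length (gamma : R -> M) : R :=
  Rintegral lebesgue_measure `[0, 1] (speed gamma).

(* [piecewise_C1_path x y l]: some piecewise C^1 path, given as a finite chain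
   of C^1 curves, goes from [x] to [y] and has length [l]. *)
Inductive piecewise_C1_path : M -> M -> R -> Prop :=
| path_nil x : piecewise_C1_path x x 0
| path_cons gamma y l : C1_curve gamma -> piecewise_C1_path (gamma 1) y l ->
    piecewise_C1_path (gamma 0) y (curve_length gamma + l).

Definition geodesic_distance (x y : M) : \bar R :=
  ereal_inf [set l%:E | l in [set l | piecewise_C1_path x y l]].

Definition bounded_subset (B : set M) : Prop :=
  exists r : R, forall x y, B x -> B y -> (geodesic_distance x y <= r%:E)%E.

(* B(E, eps) *)
Definition ball_around (E : set M) (eps : R) : set M :=
  \bigcup_(z in E) [set y | (geodesic_distance z y < eps%:E)%E].

(* Laplace-Beltrami operator, div grad *)
Definition laplacian (f : M -> R) (x : M) : R :=
  let i := chart_at A x in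
  (sqrt_det i (phi i x))^-1 *
  \sum_(a < n) partial a (fun v => sqrt_det i v *
    \sum_(b < n) ginv i v a b * partial b (f \o psi i) v) (phi i x).

Definition C2 (f : M -> R) : Prop :=
  forall i : chart A, Ck_on 2 (cod i) (f \o psi i).

End RiemannianGeometry.

Definition borel (M : ptopologicalType) := g_sigma_algebraType (@open M).

Section HeatKernel.
Variables (R : realType) (n : nat) (M : ptopologicalType).
Variables (A : smooth_atlas R n M) (g : riemannian_metric A).
Variable (vol : {measure set (borel M) -> \bar R}).

(* In each chart the volume has density sqrt(det g); this determines [vol] on
   a second countable manifold. *)
Definition riemannian_volume : Prop :=
  forall (i : chart A) (B : set (borel M)), measurable B -> B `<=` dom i ->
    vol B = lebesgue_iter (fun v : 'rV[R]_n =>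
      (\1_(phi i @` B) v * sqrt_det g i v)%:E).

(* u(x, t), t > 0, is a positive solution of the heat equation
   du/dt = 1/2 Delta u with initial datum the Dirac mass at [y] *)
Definition fundamental_solution (y : M) (u : M -> R -> R) : Prop :=
  [/\ forall x t, 0 < t -> 0 < u x t,
      forall x t, 0 < t -> {for (x, t), continuous (fun z => u z.1 z.2)},
      forall t, 0 < t -> C2 A (fun x => u x t),
      forall x t, 0 < t -> derivable (u x) t 1 /\
        derive1 (u x) t = 2^-1 * laplacian g (fun z => u z t) x &
      forall f : M -> R, continuous f ->
        (exists2 K, compact K & forall x, ~ K x -> f x = 0) ->
        (\int[vol]_x (f x * u x t)%:E)%E @[t --> 0^'+] --> (f y)%:E].

Definition minimal_heat_kernel (p : M -> M -> R -> R) : Prop :=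
  forall y, fundamental_solution y (fun x t => p x y t) /\
    forall u, fundamental_solution y u ->
      forall x t, 0 < t -> p x y t <= u x t.

Definition stochastically_complete (p : M -> M -> R -> R) : Prop :=
  forall x t, 0 < t -> (\int[vol]_y (p x y t)%:E)%E = 1%E.

End HeatKernel.

Definition argmin (d : Order.disp_t) (V : porderType d) (T : Type)
    (F : T -> V) : set T :=
  [set y | forall z, (F y <= F z)%O].

Section Estimator.
Variables (R : realType) (M : ptopologicalType) (p : M -> M -> R -> R) (t : R).
Variables (d : measure_display) (Omega : measurableType d).
Variable (P : probability Omega R).

(* E_t(X) *)
Definition diffusion_mean_set (X : {RV P >-> borel M}) : set M :=
  argmin (fun y : M => 'E_P[fun w => (- ln (p (X w) y t))%R]%E).

(* E_{t,k}(w), for k >= 1; the samples X_1, X_2, ... are Xs 0, Xs 1, ... *)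
Definition diffusion_estimator (Xs : nat -> {RV P >-> borel M}) (k : nat)
    (w : Omega) : set M :=
  argmin (fun y : M => - (k%:R^-1 * \sum_(i < k) ln (p (Xs i w) y t))).

Definition iid_samples (X : {RV P >-> borel M})
    (Xs : nat -> {RV P >-> borel M}) : Prop :=
  (forall i (B : set (borel M)), measurable B ->
    distribution P (Xs i) B = distribution P X B) /\
  (forall (s : seq nat) (B : nat -> set (borel M)), uniq s ->
    (forall i, measurable (B i)) ->
    P (\bigcap_(i in [set` s]) (Xs i @^-1` B i))
    = (\prod_(i <- s) P (Xs i @^-1` B i))%E).

End Estimator.

Section Consistency.
Variables (R : realType) (n : nat) (M : ptopologicalType).
Variables (A : smooth_atlas R n M) (g : riemannian_metric A).
Variables (d : measure_display) (Omega : measurableType d).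
Variable (P : probability Omega R).
Variables (E : set M) (En : nat -> Omega -> set M).

(* The estimators are indexed from 1. *)
Definition tail_union (k0 : nat) (w : Omega) : set M :=
  \bigcup_(k in [set k | (k0 <= k)%N]) En k w.

Definition ziezold_consistent : Prop :=
  {ae P, forall w,
    \bigcap_(k0 in [set k0 | (1 <= k0)%N]) closure (tail_union k0 w) `<=` E}.

Definition bhattacharya_patrangenaru_consistent : Prop :=
  E !=set0 /\
  forall eps : R, 0 < eps ->
    {ae P, forall w, exists2 k0 : nat, (0 < k0)%N &
      tail_union k0 w `<=` ball_around g E eps}.

Definition heine_borel_property : Prop :=
  {ae P, forall w, forall B : set M,
    B `<=` closure (tail_union 1 w) -> closed B -> bounded_subset g B ->
    compact B}.

End Consistency.

(* Main.v *)
Require Import Defs.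
From HB Require Import structures.
From mathcomp Require Import all_boot all_order all_algebra.
From mathcomp Require Import all_classical all_reals all_analysis.
From mathcomp Require Import measurable_realfun ring lra.

Set Implicit Arguments.
Unset Strict Implicit.
Unset Printing Implicit Defensive.

Import Order.TTheory GRing.Theory Num.Theory.
Import numFieldNormedType.Exports.

Local Open Scope classical_set_scope.
Local Open Scope ring_scope.

(** Suppose that, for a sample sequence in a suitable set of probability one,
    the estimators do not eventually enter [B(E, eps)], with [E] the mean set.
    Then some points of arbitrarily late estimators stay outside of it. By
    consistency in the sense of Ziezold a cluster point of these points belongs
    to [E], so they have none, and by the Heine-Borel property they cannot stay
    at bounded distance from [y0]: a subsequence goes to infinity
    ([tail_union_sub_ball_around]). Coercivity forbids this
    ([estimator_no_escape]): samples [x] with [- ln (p x y0 t) < C] have a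
    positive asymptotic frequency ([eventually_frequency_ge]) and make the
    empirical objective at these points tend to infinity, since [- ln p] is
    bounded below, [p] being bounded; but at a point [z] of the mean set the empirical objective
    stays bounded ([eventually_average_le]), because the expectation of
    [- ln (p X z t)] is finite. If it is infinite, then the mean set is the
    whole manifold and there is nothing to prove.

    Both facts on averages are one-sided forms of the strong law of large
    numbers; they follow from Chebyshev's inequality for pairwise independent
    variables along the powers of 2, a dyadic truncation, and the
    Borel-Cantelli lemma.

    On the geometric side, the geodesic distance has to be symmetric, to satisfy
    the triangle inequality and to have balls that are neighbourhoods in the
    manifold topology ([near_geodesic_distance_lt]). This rests on the chain
    rule for functions with continuous partial derivatives, from which the
    speed of a curve does not depend on the chart. *)

(** * Functions with continuous partial derivatives *)

Lemma rV_near_box (R : realType) n (v : 'rV[R]_n) (U : set 'rV[R]_n) :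
  nbhs v U -> exists2 r : R, 0 < r &
    forall u : 'rV[R]_n, (forall a, `|v 0 a - u 0 a| < r) -> U u.
Proof.
move=> /nbhs_ballP[r /= r0 rU]; exists r => // u ur; apply: rU.
by split => // i j; rewrite ord1; exact: ur.
Qed.

Lemma rV_cvg (R : realType) n (T : Type) (F : set_system T) (FF : Filter F)
    (c : T -> 'rV[R]_n) (v : 'rV[R]_n) :
  (forall a, c x 0 a @[x --> F] --> v 0 a) -> c x @[x --> F] --> v.
Proof.
move=> cv U /rV_near_box[r r0 rU].
have : \forall x \near F, forall a, `|v 0 a - c x 0 a| < r.
  apply: filter_forall => a.
  by move/cvgrPdist_lt : (cv a) => /(_ r r0).
by apply: filterS => x; exact: rU.
Qed.

(** The mean value theorem at 0, for increments of either sign. *)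
Lemma lipschitz_from_0 (R : realType) (g : R -> R) (z e : R) :
  (forall s : R, `|s| <= `|z| -> derivable g s 1 /\ `|derive1 g s| <= e) ->
  `|g z - g 0| <= e * `|z|.
Proof.
move=> gP.
have gd (s : R) : `|s| <= `|z| -> is_derive s 1 g (derive1 g s).
  by move=> /gP[] /derivableP; rewrite derive1E.
have gc (s : R) : `|s| <= `|z| -> {for s, continuous g}.
  by move=> /gP[d _]; apply: differentiable_continuous; exact/derivable1_diffP.
have [z0|z0] := leP 0 z.
  have [||c cz ->] := @MVT_segment _ g (derive1 g) 0 z z0.
  - move=> x; rewrite in_itv /= => /andP[x0 xz]; apply: gd.
    by rewrite !ger0_norm // ltW.
  - apply: continuous_in_subspaceT => x; rewrite inE /= in_itv /= => /andP[x0 xz].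
    by apply: gc; rewrite !ger0_norm.
  rewrite subr0 normrM ler_wpM2r//; move: cz; rewrite in_itv /= => /andP[x0 xz].
  by apply: (gP c _).2; rewrite !ger0_norm.
have [||c cz E] := @MVT_segment _ g (derive1 g) z 0 (ltW z0).
- move=> x; rewrite in_itv /= => /andP[x0 xz]; apply: gd.
  by rewrite !ler0_norm ?lerN2 ?(ltW x0) ?(ltW z0) ?(ltW xz).
- apply: continuous_in_subspaceT => x; rewrite inE /= in_itv /= => /andP[x0 xz].
  by apply: gc; rewrite !ler0_norm ?lerN2 // ltW.
rewrite -normrN opprB E sub0r normrM normrN ler_wpM2r//.
move: cz; rewrite in_itv /= => /andP[x0 xz].
by apply: (gP c _).2; rewrite !ler0_norm ?lerN2 // ltW.
Qed.

Lemma coordinate_line_shift (R : realType) n (a : 'I_n) (f : 'rV[R]_n -> R) v (s : R) :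
  coordinate_line a f (v + s *: delta_mx 0 a) = coordinate_line a f v \o shift s.
Proof.
by apply/funext => h; rewrite /coordinate_line /= -addrA -scalerDl addrC [s + h]addrC addrC.
Qed.

Lemma derive_coordinate_line (R : realType) n (a : 'I_n) (f : 'rV[R]_n -> R) v (s : R) :
  derivable (coordinate_line a f (v + s *: delta_mx 0 a)) 0 1 ->
  is_derive s 1 (coordinate_line a f v)
    (partial a f (v + s *: delta_mx 0 a)).
Proof.
rewrite /partial coordinate_line_shift => df.
have /derivableP dF := df.
have E : coordinate_line a f v
    = (coordinate_line a f v \o shift s) \o (fun x => x - s).
  by apply/funext => x /=; rewrite subrK.
rewrite {1}E; apply: is_derive_eq.
  apply: is_derive1_comp; rewrite subrr; exact: dF.
by rewrite subr0 mulr1 derive1E.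
Qed.

(** A function with continuous partial derivatives is differentiable: go from
    [v] to [u] by changing one coordinate at a time, and apply the mean value
    theorem to each of the [n] steps. *)
Lemma differentiable_of_partials (R : realType) n (f : 'rV[R]_n -> R) v (e : R) :
  0 < e ->
  (forall a, \forall w \near v, derivable (coordinate_line a f w) 0 1) ->
  (forall a, {for v, continuous (partial a f)}) ->
  \forall u \near v,
    `|f u - f v - \sum_a partial a f v * (u 0 a - v 0 a)|
      <= e * \sum_a `|u 0 a - v 0 a|.
Proof.
move=> e0 df cf.
have : \forall w \near v, forall a, derivable (coordinate_line a f w) 0 1
    /\ `|partial a f v - partial a f w| <= e.
  apply: (@filter_forall _ _ (fun a w => derivable (coordinate_line a f w) 0 1
    /\ `|partial a f v - partial a f w| <= e) (nbhs v)) => a.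
  apply: filterI; first exact: df.
  by move/cvgrPdist_le : (cf a) => /(_ e e0).
move=> /rV_near_box[r r0 rP].
apply/nbhs_ballP; exists r => //= u [_ /(_ 0) vu].
(* The corners of the path: coordinates below [k] already come from [u]. *)
pose w k : 'rV[R]_n := \row_a (if (a < k)%N then u 0 a else v 0 a).
have -> : f u - f v = \sum_(a < n) (f (w a.+1) - f (w a)).
  rewrite -(big_mkord xpredT (fun k => f (w k.+1) - f (w k))) telescope_sumr//.
  congr (f _ - f _); apply/rowP => a; rewrite mxE ?ltn_ord //.
rewrite -sumrB mulr_sumr; apply: le_trans (ler_norm_sum _ _ _) _.
apply: ler_sum => a _; set z := u 0 a - v 0 a.
pose g (s : R) := coordinate_line a f (w a) s - partial a f v * s.
have -> : f (w a.+1) - f (w a) - partial a f v * z = g z - g 0.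
  rewrite /g mulr0 subr0 /coordinate_line scale0r addr0 addrAC; congr (f _ - _ - _).
  apply/rowP => b; rewrite !mxE eqxx andTb ltnS leq_eqVlt.
  case: (eqVneq b a) => [->|ba]; first by rewrite eqxx ltnn mulr1 addrC subrK.
  by rewrite val_eqE (negbTE ba) mulr0 addr0.
apply: (@lipschitz_from_0 _ g z e) => s sz.
have [ds ps] : derivable (coordinate_line a f (w a + s *: delta_mx 0 a)) 0 1
    /\ `|partial a f v - partial a f (w a + s *: delta_mx 0 a)| <= e.
  apply: rP => b; rewrite !mxE eqxx andTb.
  case: (eqVneq b a) => [->|ba].
    rewrite ltnn mulr1 opprD addNKr normrN; apply: le_lt_trans sz _.
    by rewrite /z distrC; exact: vu.
  rewrite mulr0 addr0; case: ifP => _; first exact: vu.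
  by rewrite subrr normr0.
have dg : is_derive s 1 g (partial a f (w a + s *: delta_mx 0 a) - partial a f v).
  apply: is_deriveB; first exact: derive_coordinate_line.
  by apply: is_derive_eq; rewrite -[X in X = _]/(_ * 1) mulr1.
split; first exact: ex_derive.
by rewrite derive1E derive_val distrC.
Qed.

(** Differentiability as a first-order estimate on a full neighbourhood; unlike
    the difference quotient it needs no punctured filter. *)
Lemma is_derive1P (R : realType) (f : R -> R) (t l : R) :
  is_derive t 1 f l <-> forall e, 0 < e ->
    \forall s \near t, `|f s - f t - l * (s - t)| <= e * `|s - t|.
Proof.
pose q (h : R) := h^-1 *: ((f \o shift t) (h *: 1) - f t).
have qE (h : R) : q h = h^-1 * (f (h + t) - f t).
  by rewrite /q /= -[h *: 1]/(h * 1) mulr1.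
have key (e h : R) : h != 0 ->
    (`|l - q h| <= e) = (`|f (h + t) - f t - l * h| <= e * `|h|).
  move=> h0; rewrite -ler_pdivrMr ?normr_gt0// -normfV -normrM distrC qE.
  congr (`| _ | <= _); rewrite mulrBl -mulrA divff// mulr1 [X in _ = X - _]mulrC //.
split=> [[df dl] e e0|fl].
  have : q h @[h --> 0^'] --> l by rewrite -dl.
  move=> /cvgrPdist_le /(_ e e0); rewrite near_withinE => H.
  rewrite (near_shift 0) /= subr0; near=> h; rewrite /= addrK.
  have [->|h0] := eqVneq h 0; first by rewrite add0r subrr normr0 !mulr0 subr0 normr0.
  by rewrite -key//; apply: (near H h) => //.
suff ql : q h @[h --> 0^'] --> l.
  by apply: DeriveDef; [apply: cvgP ql|exact: cvg_lim ql].
apply/cvgrPdist_le => e e0; rewrite near_withinE.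
have := fl e e0; rewrite (near_shift 0) /= subr0 => H.
near=> h => h0; rewrite key//.
by have := near H h; rewrite /= addrK; apply.
Unshelve. all: by end_near. Qed.

Lemma chain_rule_partials (R : realType) n (f : 'rV[R]_n -> R)
    (c : R -> 'rV[R]_n) (dc : 'rV[R]_n) (t : R) :
  (forall a, \forall w \near c t, derivable (coordinate_line a f w) 0 1) ->
  (forall a, {for c t, continuous (partial a f)}) ->
  (forall a, is_derive t 1 (fun s => c s 0 a) (dc 0 a)) ->
  is_derive t 1 (f \o c) (\sum_a partial a f (c t) * dc 0 a).
Proof.
move=> df pf cd.
have cc : {for t, continuous c}.
  apply: rV_cvg => a.
  suff : {for t, continuous (fun s => c s 0 a)} by [].
  by apply: differentiable_continuous; apply/derivable1_diffP; case: (cd a).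
apply/is_derive1P => e e0.
set P := \sum_a `|partial a f (c t)|; set D := \sum_a (`|dc 0 a| + 1).
have P0 : 0 <= P by apply: sumr_ge0.
have D0 : 0 <= D by apply: sumr_ge0 => a _; rewrite addr_ge0.
(* [D] bounds the increments of the coordinates of [c] and [P] their weights;
   each of the two error terms below then takes half of [e]. *)
pose e1 := e / 2 / (D + 1); pose e2 := Num.min 1 (e / 2 / (P + 1)).
have e10 : 0 < e1 by rewrite !divr_gt0// ltr_wpDl.
have e20 : 0 < e2 by rewrite lt_min ltr01 !divr_gt0// ltr_wpDl.
have F1 := cc _ (differentiable_of_partials e10 df pf).
have F2 : \forall s \near t, forall a,
    `|c s 0 a - c t 0 a - dc 0 a * (s - t)| <= e2 * `|s - t|.
  apply: (@filter_forall _ _ (fun a s =>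
    `|c s 0 a - c t 0 a - dc 0 a * (s - t)| <= e2 * `|s - t|) (nbhs t)) => a.
  by move/is_derive1P : (cd a); apply.
near=> s.
have G1 : `|f (c s) - f (c t) - \sum_a partial a f (c t) * (c s 0 a - c t 0 a)|
      <= e1 * \sum_a `|c s 0 a - c t 0 a| by near: s; exact: F1.
have G2 a : `|c s 0 a - c t 0 a - dc 0 a * (s - t)| <= e2 * `|s - t|.
  by move: a; near: s; exact: F2.
have G3 : \sum_a `|c s 0 a - c t 0 a| <= D * `|s - t|.
  rewrite /D mulr_suml; apply: ler_sum => a _.
  rewrite -[X in `|X|](subrK (dc 0 a * (s - t))) mulrDl mul1r addrC.
  apply: le_trans (ler_normD _ _) _; rewrite normrM lerD2l.
  apply: le_trans (G2 a) _; rewrite ler_piMl// ge_min lexx //.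
have G4 : `|\sum_a partial a f (c t) * (c s 0 a - c t 0 a)
     - (\sum_a partial a f (c t) * dc 0 a) * (s - t)| <= P * e2 * `|s - t|.
  rewrite mulr_suml -sumrB -mulrA mulr_suml.
  apply: le_trans (ler_norm_sum _ _ _) _; apply: ler_sum => a _.
  by rewrite -mulrA -mulrBr normrM ler_wpM2l.
rewrite /= -[X in `|X|](subrKA
  (\sum_a partial a f (c t) * (c s 0 a - c t 0 a))).
apply: le_trans (ler_normD _ _) _.
apply: le_trans (lerD G1 G4) _.
apply: le_trans (lerD (ler_wpM2l (ltW e10) G3) (lexx _)) _.
rewrite mulrA -mulrDl ler_wpM2r//.
have H1 : e1 * D <= e / 2.
  by rewrite /e1 mulrAC ler_pdivrMr ?ltr_wpDl// ler_wpM2l ?lerDl// ltW// divr_gt0.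
have H2 : P * e2 <= e / 2.
  apply: (@le_trans _ _ (P * (e / 2 / (P + 1)))).
    by rewrite ler_wpM2l// ge_min lexx orbT.
  by rewrite mulrC mulrAC ler_pdivrMr ?ltr_wpDl// ler_wpM2l ?lerDl// ltW// divr_gt0.
lra.
Unshelve. all: by end_near. Qed.

(** * Curves in charts *)

Lemma cvg_sum_fin (R : realType) (T : Type) (F : set_system T) (I : finType)
    (f : I -> T -> R) (l : I -> R) : Filter F ->
  (forall i, f i x @[x --> F] --> l i) ->
  \sum_i f i x @[x --> F] --> \sum_i l i.
Proof. by move=> FF fl; apply: cvg_big => // x; exact: add_continuous. Qed.

Section Manifold.
Variables (R : realType) (n : nat) (M : topologicalType).
Variables (A : smooth_atlas R n M) (g : riemannian_metric A).
Implicit Types (i j : chart A) (x y : M) (gamma : R -> M) (t : R).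

Definition transition i j (b : 'I_n) (v : 'rV[R]_n) : R := phi j (psi i v) 0 b.

Lemma cod_phi i x : dom i x -> cod i (phi i x).
Proof. by move=> ix; exists x. Qed.

Lemma cod_psi i v : cod i v -> dom i (psi i v).
Proof. by move=> [x ix <-]; rewrite phiK. Qed.

Lemma psiK i v : cod i v -> phi i (psi i v) = v.
Proof. by move=> [x ix <-]; rewrite phiK. Qed.

Lemma near_overlap i j x : dom i x -> dom j x ->
  \forall v \near phi i x, (phi i @` (dom i `&` dom j)) v.
Proof.
move=> ix jx; near=> v.
have iv : cod i v.
  by near: v; apply: open_nbhs_nbhs; split; [exact: cod_open|exact: cod_phi].
have jv : dom j (psi i v).
  near: v; apply: (@psi_continuous _ _ _ A i _ (cod_phi ix)).
  by rewrite phiK//; apply: open_nbhs_nbhs; split => //; exact: dom_open.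
by exists (psi i v); [split => //; exact: cod_psi|exact: psiK].
Unshelve. all: by end_near. Qed.

Lemma transition_derivable i j b a x : dom i x -> dom j x ->
  \forall w \near phi i x, derivable (Defs.coordinate_line a (transition i j b) w) 0 1.
Proof.
move=> ix jx; apply: filterS (near_overlap ix jx) => w Uw.
by have [_ /(_ (ltn0Sn _) a)] := @transition_smooth _ _ _ A i j b 1%N [::]
  isT w Uw.
Qed.

Lemma transition_partial_continuous i j b a x : dom i x -> dom j x ->
  {for phi i x, continuous (partial a (transition i j b))}.
Proof.
move=> ix jx; have Uw : (phi i @` (dom i `&` dom j)) (phi i x) by exists x.
by have [] := @transition_smooth _ _ _ A i j b 1%N [:: a] isT _ Uw.
Qed.

Lemma near_dom i gamma t : {for t, continuous gamma} -> dom i (gamma t) ->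
  \forall s \near t, dom i (gamma s).
Proof. by move=> gc it; apply: gc; apply: open_nbhs_nbhs; split => //; exact: dom_open. Qed.

(** The chain rule through the transition map: coordinates in the chart [j] are a
    smooth function of the coordinates in the chart [i]. *)
Lemma coord_change i j gamma t :
  (\forall s \near t, dom i (gamma s)) -> dom j (gamma t) ->
  (forall a, derivable (Defs.coord i gamma a) t 1) ->
  forall b, is_derive t 1 (Defs.coord j gamma b)
    ((velocity i gamma t *m transition_jacobian i j (phi i (gamma t))) 0 b).
Proof.
move=> it jt dt b.
have it0 := nbhs_singleton it.
apply: near_eq_is_derive (_ : is_derive t 1 (transition i j b \o (phi i \o gamma)) _).
  by apply: filterS it => s si; rewrite /transition /= phiK.
rewrite mxE; under eq_bigr do rewrite mulrC [transition_jacobian _ _ _ _ _]mxE.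
apply: chain_rule_partials => a.
- exact: transition_derivable.
- exact: transition_partial_continuous.
- by rewrite mxE derive1E; apply: derivableP; exact: dt.
Qed.

Lemma velocity_change i j gamma t :
  (\forall s \near t, dom i (gamma s)) -> dom j (gamma t) ->
  (forall a, derivable (Defs.coord i gamma a) t 1) ->
  velocity j gamma t = velocity i gamma t *m
    transition_jacobian i j (phi i (gamma t)).
Proof.
move=> it jt dt; apply/rowP => b; rewrite mxE derive1E.
by have [_ ->] := coord_change it jt dt b.
Qed.

(** The Jacobian that transforms the velocity cancels against the one in the
    compatibility condition of the metric. *)
Lemma gdot_change i j gamma t :
  (\forall s \near t, dom i (gamma s)) -> dom j (gamma t) ->
  (forall a, derivable (Defs.coord i gamma a) t 1) ->
  gdot g j (phi j (gamma t)) (velocity j gamma t) (velocity j gamma t)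
  = gdot g i (phi i (gamma t)) (velocity i gamma t) (velocity i gamma t).
Proof.
move=> it jt dt; rewrite /gdot (velocity_change it jt dt).
rewrite (gram_compat g (nbhs_singleton it) jt) /= trmx_mul.
by rewrite !mulmxA.
Qed.

(** The speed is defined with a chart that changes along the curve; near a given
    time one chart suffices. *)
Lemma speed_chart i gamma t :
  (\forall s \near t, dom i (gamma s)) ->
  (forall a, derivable (Defs.coord i gamma a) t 1) ->
  speed g gamma t =
  Num.sqrt (gdot g i (phi i (gamma t)) (velocity i gamma t) (velocity i gamma t)).
Proof.
by move=> it dt; rewrite /speed (gdot_change it (dom_chart_at _ _) dt).
Qed.

(** The condition [C1_at] tested in a single chart only, but with the curve known
    to stay in that chart nearby; [C1_in_chart_at] shows that this is enough. *)
Definition C1_in_chart i gamma t :=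
  (\forall s \near t, dom i (gamma s) /\ forall a, derivable (Defs.coord i gamma a) s 1)
  /\ forall a, {for t, continuous (derive1 (Defs.coord i gamma a))}.

Lemma C1_at_in_chart i gamma t : C1_at A gamma t -> dom i (gamma t) ->
  C1_in_chart i gamma t.
Proof.
move=> [gc gd] it; split=> [|a]; last by have [] := gd i it a.
apply: filterI; first exact: near_dom.
apply: (@filter_forall _ _ (fun a s => derivable (Defs.coord i gamma a) s 1)
  (nbhs t)) => a.
by have [] := gd i it a.
Qed.

Lemma phi_cvg i gamma t : (forall a, derivable (Defs.coord i gamma a) t 1) ->
  {for t, continuous (phi i \o gamma)}.
Proof.
move=> dt; apply: rV_cvg => a.
suff : {for t, continuous (Defs.coord i gamma a)} by [].
by apply: differentiable_continuous; apply/derivable1_diffP; exact: dt.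
Qed.

Lemma C1_in_chart_at i gamma t : C1_in_chart i gamma t -> C1_at A gamma t.
Proof.
move=> [nt ct]; have [it dt] := nbhs_singleton nt.
have gc : {for t, continuous gamma}.
  have E : \forall s \near t, (psi i \o (phi i \o gamma)) s = gamma s.
    by apply: filterS nt => s [si _]; rewrite /= phiK.
  have psi_cvg : psi i (phi i (gamma s)) @[s --> t] --> psi i (phi i (gamma t)).
    apply: (cvg_comp (phi i \o gamma) (psi i)); first exact: phi_cvg.
    exact: psi_continuous (cod_phi it).
  rewrite phiK// in psi_cvg.
  by apply: cvg_trans psi_cvg; exact: near_eq_cvg.
split => // j jt b.
have D : \forall s \near t, is_derive (s : R) 1 (Defs.coord j gamma b)
    ((velocity i gamma s *m transition_jacobian i j (phi i (gamma s))) 0 b).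
  have jn := near_dom gc jt.
  have iN : \forall s \near t, dom i (gamma s) by apply: filterS nt => s [].
  near=> s.
  apply: coord_change.
  - by near: s; exact: (near_join iN).
  - by near: s.
  - by near: s; apply: filterS nt => s' [].
split; first by apply: filterS D => s [].
have E : \forall s \near t,
    (velocity i gamma s *m transition_jacobian i j (phi i (gamma s))) 0 b
    = derive1 (Defs.coord j gamma b) s.
  by apply: filterS D => s ds; rewrite derive1E derive_val.
suff F : (velocity i gamma s *m transition_jacobian i j (phi i (gamma s))) 0 b
    @[s --> t] --> derive1 (Defs.coord j gamma b) t.
  by apply: cvg_trans F; exact: near_eq_cvg.
rewrite -(nbhs_singleton E).
under eq_fun do rewrite mxE.
rewrite mxE; apply: cvg_sum_fin => a.
apply: cvgM.
  by under eq_fun do rewrite mxE; rewrite mxE; exact: ct.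
under eq_fun do rewrite mxE; rewrite mxE.
have := @transition_partial_continuous i j b a _ it jt.
by apply: (cvg_comp (phi i \o gamma)); exact: phi_cvg.
Unshelve. all: by end_near. Qed.
End Manifold.

(** * The geodesic distance *)

Section Curves.
Variables (R : realType) (n : nat) (M : topologicalType).
Variables (A : smooth_atlas R n M) (g : riemannian_metric A).
Implicit Types (i j : chart A) (x y : M) (gamma : R -> M) (t : R).

Lemma gdotE i v (u w : 'rV[R]_n) :
  gdot g i v u w = \sum_b (\sum_a u 0 a * gram g i v a b) * w 0 b.
Proof. by rewrite /gdot mxE; apply: eq_bigr => b _; rewrite !mxE. Qed.

Lemma gram_continuous i v a b : cod i v ->
  {for v, continuous (fun w => gram g i w a b)}.
Proof. by move=> iv; have [] := @gram_smooth _ _ _ _ g i a b 0%N [::] isT v iv. Qed.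

Lemma speed_continuous gamma t : C1_at A gamma t ->
  {for t, continuous (speed g gamma)}.
Proof.
move=> gC; have it := dom_chart_at A (gamma t).
set i := chart_at A (gamma t) in it.
have [nt ct] := C1_at_in_chart gC it.
have [_ dt] := nbhs_singleton nt.
have iN : \forall s \near t, dom i (gamma s) by apply: filterS nt => s [].
have E : \forall s \near t, Num.sqrt (gdot g i (phi i (gamma s))
    (velocity i gamma s) (velocity i gamma s)) = speed g gamma s.
  near=> s; apply/esym/speed_chart; first by near: s; exact: (near_join iN).
  by near: s; apply: filterS nt => s [].
suff F : Num.sqrt (gdot g i (phi i (gamma s)) (velocity i gamma s)
    (velocity i gamma s)) @[s --> t] --> speed g gamma t.
  by apply: cvg_trans F; exact: near_eq_cvg.
rewrite -(nbhs_singleton E).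
have vc a : velocity i gamma s 0 a @[s --> t] --> velocity i gamma t 0 a.
  by under eq_fun do rewrite mxE; rewrite mxE; exact: ct.
have gc : gdot g i (phi i (gamma s)) (velocity i gamma s) (velocity i gamma s)
    @[s --> t] --> gdot g i (phi i (gamma t)) (velocity i gamma t) (velocity i gamma t).
  rewrite gdotE; under eq_fun do rewrite gdotE.
  apply: cvg_sum_fin => b; apply: cvgM; last exact: vc.
  apply: cvg_sum_fin => a; apply: cvgM; first exact: vc.
  apply: (@continuous_comp _ _ _ (phi i \o gamma) (fun w => gram g i w a b)).
    exact: phi_cvg.
  by apply: gram_continuous; exact: cod_phi.
by apply: cvg_comp gc _; exact: sqrt_continuous.
Unshelve. all: by end_near. Qed.

Lemma speed_within_continuous gamma : C1_curve A gamma ->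
  {within `[0, 1], continuous (speed g gamma)}.
Proof.
move=> gC; apply: continuous_in_subspaceT => t; rewrite inE /= in_itv /= => t01.
by apply: speed_continuous; exact: gC.
Qed.

Definition reverse gamma : R -> M := fun s => gamma (1 - s).

Lemma onem_continuous t : (1 - s) @[s --> t] --> 1 - t.
Proof. by apply: cvgB; [exact: cvg_cst|exact: cvg_id]. Qed.

Lemma near_onem (P : set R) t :
  (\forall s \near 1 - t, P s) -> \forall s \near t, P (1 - s).
Proof. exact: onem_continuous. Qed.

Lemma reverse_coord i gamma a t : derivable (Defs.coord i gamma a) (1 - t) 1 ->
  is_derive t 1 (Defs.coord i (reverse gamma) a)
    (- derive1 (Defs.coord i gamma a) (1 - t)).
Proof.
move=> /derivableP dt.
have E : Defs.coord i (reverse gamma) a = Defs.coord i gamma a \o (fun s => 1 - s).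
  by [].
have d1 : is_derive t 1 (fun s : R => 1 - s) (-1).
  by rewrite -[-1]sub0r; exact: is_deriveB.
rewrite E derive1E -mulrN1; exact: is_derive1_comp.
Qed.

Lemma C1_at_reverse gamma t : C1_at A gamma (1 - t) -> C1_at A (reverse gamma) t.
Proof.
move=> gC; have it := dom_chart_at A (gamma (1 - t)).
set i := chart_at A (gamma (1 - t)) in it.
have [nt ct] := C1_at_in_chart gC it.
have nt' : \forall s \near t, dom i (gamma (1 - s)) /\
    forall a, derivable (Defs.coord i gamma a) (1 - s) 1.
  exact: near_onem nt.
apply: (@C1_in_chart_at _ _ _ A i); rewrite /C1_in_chart; split.
  apply: filterS nt' => s [si ds]; split; [exact: si|move=> a].
  by have [] := reverse_coord (ds a).
move=> a.
have E : \forall s \near t, - derive1 (Defs.coord i gamma a) (1 - s)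
    = derive1 (Defs.coord i (reverse gamma) a) s.
  apply: filterS nt' => s [_ ds].
  by rewrite [RHS]derive1E; have [_ ->] := reverse_coord (ds a).
suff F : - derive1 (Defs.coord i gamma a) (1 - s) @[s --> t]
    --> derive1 (Defs.coord i (reverse gamma) a) t.
  by apply: cvg_trans F; exact: near_eq_cvg.
rewrite -(nbhs_singleton E); apply: cvgN.
by apply: (cvg_comp (fun s => 1 - s)); [exact: onem_continuous|exact: ct].
Qed.

Lemma speed_reverse gamma t : C1_at A gamma (1 - t) ->
  speed g (reverse gamma) t = speed g gamma (1 - t).
Proof.
move=> gC; have it := dom_chart_at A (gamma (1 - t)).
have [nt _] := C1_at_in_chart gC it.
have [_ dt] := nbhs_singleton nt.
rewrite /speed /reverse; set i := chart_at A (gamma (1 - t)) in it dt *.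
have -> : velocity i (reverse gamma) t = - velocity i gamma (1 - t).
  apply/rowP => a; rewrite !mxE [LHS]derive1E.
  by have [_ ->] := reverse_coord (dt a).
by rewrite /gdot linearN mulNmx mulmxN mulNmx opprK.
Qed.

Lemma onem_itv t : 0 <= t <= 1 -> 0 <= 1 - t <= 1.
Proof. by move=> /andP[? ?]; rewrite subr_ge0 lerBlDl lerDr; apply/andP. Qed.

Lemma C1_curve_reverse gamma : C1_curve A gamma -> C1_curve A (reverse gamma).
Proof. by move=> gC t /onem_itv t01; apply: C1_at_reverse; exact: gC. Qed.

(** Substitution [s |-> 1 - s] in the integral, which is allowed because the
    speed of a C^1 curve is continuous. *)
Lemma curve_length_reverse gamma : C1_curve A gamma ->
  curve_length g (reverse gamma) = curve_length g gamma.
Proof.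
move=> gC; have o01 : 0 <= (1 : R) <= 1 by rewrite ler01 lexx.
rewrite /curve_length.
have E := @Rintegration_by_substitution_onem _ (speed g gamma) 1 o01
  (speed_within_continuous gC).
rewrite unstable.onem1 in E.
apply/esym/(etrans E); apply/esym; apply: eq_Rintegral => t.
rewrite inE /= in_itv /= => /onem_itv t01.
by apply: speed_reverse; exact: gC.
Qed.

(** The geodesic distance is symmetric and satisfies the triangle inequality
    because paths can be concatenated and reversed without changing lengths. *)
Lemma path_cat x y z l m : piecewise_C1_path g x y l ->
  piecewise_C1_path g y z m -> piecewise_C1_path g x z (l + m).
Proof.
move=> p; elim: p z m => [w z m|gamma w {}l gC _ IH z m q]; first by rewrite add0r.
by rewrite -addrA; apply: path_cons => //; exact: IH.
Qed.

Lemma path_reverse x y l : piecewise_C1_path g x y l -> piecewise_C1_path g y x l.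
Proof.
elim=> [w|gamma w m gC _ IH]; first exact: path_nil.
rewrite addrC; apply: path_cat IH _.
have := path_cons (C1_curve_reverse gC) (path_nil g (reverse gamma 1)).
by rewrite addr0 /reverse subr0 subrr curve_length_reverse.
Qed.

Lemma geodesic_distance_sym x y : geodesic_distance g x y = geodesic_distance g y x.
Proof.
rewrite /geodesic_distance; congr ereal_inf; apply/seteqP.
by split=> _ [l /path_reverse lP <-]; exists l.
Qed.

Lemma geodesic_distance_le x y l : piecewise_C1_path g x y l ->
  (geodesic_distance g x y <= l%:E)%E.
Proof. by move=> p; apply: ereal_inf_lbound; exists l. Qed.

Lemma geodesic_distance_ltP x y (r : R) : (geodesic_distance g x y < r%:E)%E ->
  exists2 l, piecewise_C1_path g x y l & l < r.
Proof. by move=> /ereal_inf_lt[_ [l lP <-]]; rewrite lte_fin; exists l. Qed.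

Lemma geodesic_distance_triangle x y z (r s : R) :
  (geodesic_distance g x y < r%:E)%E -> (geodesic_distance g y z < s%:E)%E ->
  (geodesic_distance g x z < (r + s)%:E)%E.
Proof.
move=> /geodesic_distance_ltP[l pl lr] /geodesic_distance_ltP[m pm ms].
apply: le_lt_trans (geodesic_distance_le (path_cat pl pm)) _.
by rewrite lte_fin ltrD.
Qed.

Lemma curve_length_le gamma (c : R) : C1_curve A gamma ->
  (forall t, 0 <= t <= 1 -> speed g gamma t <= c) -> curve_length g gamma <= c.
Proof.
move=> gC sc; rewrite /curve_length.
have -> : c = (\int[lebesgue_measure]_(t in `[0, 1]%classic) c)%R.
  have m1 : lebesgue_measure (`[0, 1]%classic : set R) = 1%E.
    by rewrite lebesgue_measure_itv /= lte_fin ltr01 oppr0 adde0.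
  apply/esym; apply: etrans (Rintegral_cst _ _ _) _ => //.
  by rewrite [X in fine X](_ : _ = 1%E) ?mulr1//; exact: m1.
apply: le_Rintegral => //.
- apply: continuous_compact_integrable; first exact: segment_compact.
  exact: speed_within_continuous.
- apply: continuous_compact_integrable; first exact: segment_compact.
  by apply: continuous_subspaceT => ?; exact: cvg_cst.
Qed.

(** A point close to [x] in the manifold topology is joined to [x] by a segment in a chart, whose length is
    controlled by a local bound [K] on the coefficients of the metric. *)
Lemma near_geodesic_distance_lt x (eps : R) : 0 < eps ->
  \forall y \near x, (geodesic_distance g x y < eps%:E)%E.
Proof.
move=> e0; have ix := dom_chart_at A x; set i := chart_at A x in ix.
set v := phi i x; have iv : cod i v by exact: cod_phi.
pose K : R := \sum_a \sum_b `|gram g i v a b| + 1.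
have K1 : 1 <= K by rewrite lerDr; do 2!apply: sumr_ge0 => ? _.
have : \forall w \near v, cod i w /\
    forall a, forall b, `|gram g i w a b| <= K.
  apply: filterI; first by apply: open_nbhs_nbhs; split => //; exact: cod_open.
  apply: (@filter_forall _ _ (fun a w => forall b, `|gram g i w a b| <= K) (nbhs v)) => a.
  apply: (@filter_forall _ _ (fun b w => `|gram g i w a b| <= K) (nbhs v)) => b.
  have /cvgrPdist_le/(_ 1 ltr01) := @gram_continuous i v a b iv.
  apply: filterS => w gw.
  rewrite -[X in `|X|](subrK (gram g i v a b)) addrC /K.
  apply: le_trans (ler_normD _ _) (lerD _ _); last by rewrite distrC.
  rewrite (bigD1 a)//= (bigD1 b)//= -addrA lerDl addr_ge0//.
    by apply: sumr_ge0.
  by do 2!apply: sumr_ge0 => ? _.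
move=> /rV_near_box[r r0 rP].
pose N : R := n%:R * K + 1.
have N0 : 0 < N by rewrite ltr_wpDl// mulr_ge0// (le_trans ler01).
(* The bound [r / 2] leaves room to run the segment on the parameters
   [-2 < s < 2], a neighbourhood of [0, 1]; the second bound makes the
   speed at most [eps / 2]. *)
pose dl := Num.min (r / 2) (eps / 2 / N).
have dl0 : 0 < dl by rewrite lt_min !divr_gt0.
have : \forall y \near x, dom i y /\ forall a, `|v 0 a - phi i y 0 a| < dl.
  apply: filterI; first by apply: open_nbhs_nbhs; split => //; exact: dom_open.
  have box : nbhs v [set w : 'rV[R]_n | forall a, `|v 0 a - w 0 a| < dl].
    by apply/nbhs_ballP; exists dl => //= w [_ vw] a; exact: (vw 0).
  exact: (phi_continuous ix box).
apply: filterS => y [iy vy].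
set u := phi i y - v.
have uE a : `|u 0 a| < dl by rewrite !mxE distrC.
pose c (s : R) : 'rV[R]_n := v + s *: u.
pose gamma (s : R) : M := psi i (c s).
have cP (s : R) : `|s| < 2 -> cod i (c s) /\
    forall a b, `|gram g i (c s) a b| <= K.
  move=> s2; apply: rP => a; rewrite 2!mxE opprD addNKr normrN normrM.
  have dr : dl <= r / 2 by rewrite ge_min lexx.
  apply: (@le_lt_trans _ _ (`|s| * (r / 2))).
    by rewrite ler_wpM2l// (le_trans (ltW (uE a)) dr).
  by rewrite mulrA ltr_pdivrMr// mulrC ltr_pM2l.
have cK (s : R) : `|s| < 2 -> phi i (gamma s) = c s.
  by move=> /cP[is_ _]; rewrite psiK.
have near2 (s : R) : 0 <= s <= 1 -> \forall s' \near s, `|s'| < 2.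
  move=> /andP[s0 s1].
  have : {for s, continuous (@Num.norm R R)} by exact: norm_continuous.
  move/cvgr_lt; apply; rewrite ger0_norm//; lra.
have cd (s : R) a : `|s| < 2 -> is_derive s 1 (Defs.coord i gamma a) (u 0 a).
  move=> s2.
  apply: near_eq_is_derive
    (_ : is_derive s 1 (fun s' : R => v 0 a + s' * u 0 a) (u 0 a)).
    have : {for s, continuous (@Num.norm R R)} by exact: norm_continuous.
    move/cvgr_lt => /(_ _ s2).
    by apply: filterS => s' s2'; rewrite /Defs.coord cK// !mxE.
  apply/is_derive1P => e' e'0; near=> s'.
  have -> : v 0 a + s' * u 0 a - (v 0 a + s * u 0 a) - u 0 a * (s' - s) = 0 by ring.
  by rewrite normr0 mulr_ge0// ltW.
have gC : C1_curve A gamma.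
  move=> s s01; have n2 := near2 s s01.
  apply: (@C1_in_chart_at _ _ _ A i); rewrite /C1_in_chart; split.
    apply: filterS n2 => s' s2; split; first by apply: cod_psi; case: (cP _ s2).
    by move=> a; have [] := cd _ a s2.
  move=> a.
  have E : \forall s' \near s, u 0 a = derive1 (Defs.coord i gamma a) s'.
    apply: filterS n2 => s' s2; rewrite derive1E.
    by have [_ ->] := cd _ a s2.
  suff F : u 0 a @[_ --> s] --> derive1 (Defs.coord i gamma a) s.
    by apply: cvg_trans F; exact: near_eq_cvg.
  by rewrite -(nbhs_singleton E); exact: cvg_cst.
have len : curve_length g gamma <= eps / 2.
  apply: curve_length_le => // s s01.
  have n2 := near2 s s01; have s2 := nbhs_singleton n2.
  rewrite (@speed_chart _ _ _ A g i).
  - have -> : velocity i gamma s = u.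
      by apply/rowP => a; rewrite mxE derive1E; have [_ ->] := cd _ a s2.
    rewrite (cK _ s2).
    have e2E : Num.sqrt ((eps / 2) ^+ 2) = eps / 2.
      by rewrite sqrtr_sqr ger0_norm// divr_ge0// ltW.
    rewrite -[leRHS]e2E; apply: ler_wsqrtr.
    have [_ gK] := cP _ s2.
    have Ndl : N * dl <= eps / 2.
      by rewrite mulrC -ler_pdivlMr// ge_min lexx orbT.
    apply: (@le_trans _ _ (\sum_(b < n) \sum_(a < n) dl * K * dl)).
      rewrite gdotE; apply: ler_sum => b _; rewrite mulr_suml.
      apply: ler_sum => a _; apply: le_trans (ler_norm _) _.
      rewrite !normrM; apply: ler_pM => //; last exact: ltW.
      by apply: ler_pM => //; exact: ltW.
    rewrite !sumr_const !card_ord.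
    apply: (@le_trans _ _ ((N * dl) ^+ 2)).
      have n0 : 0 <= n%:R :> R by [].
      have K0 : 0 <= K by apply: le_trans K1.
      have -> : dl * K * dl *+ n *+ n = (n%:R ^+ 2 * K) * dl ^+ 2 by ring.
      rewrite exprMn ler_wpM2r ?sqr_ge0// /N.
      have : n%:R ^+ 2 * K <= (n%:R * K) ^+ 2.
        by rewrite exprMn ler_wpM2l ?sqr_ge0// expr2 ler_peMl.
      have : 0 <= n%:R * K by rewrite mulr_ge0.
      nra.
    by rewrite ler_sqr// nnegrE ?divr_ge0 ?mulr_ge0 ?ltW.
  - by apply: filterS n2 => s' s2'; apply: cod_psi; case: (cP _ s2').
  - by move=> a; have [] := cd _ a s2.
have := path_cons gC (path_nil g (gamma 1)).
rewrite addr0 /gamma /c scale0r addr0 scale1r /u addrC subrK !phiK//.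
move=> /geodesic_distance_le/le_lt_trans; apply; rewrite lte_fin.
apply: le_lt_trans len _; lra.
Unshelve. all: by end_near. Qed.

End Curves.

(** * Moments of pairwise independent samples *)

(** The terms grow like [2 ^+ k] while [2 ^+ k <= z] and decay like
    [z ^+ 2 / 2 ^+ k] afterwards, so the largest one dominates the sum. *)
Lemma min_square_dyadic_sum (R : realType) (z : R) (K : nat) : 0 <= z ->
  \sum_(k < K) Num.min z (2 ^+ k) ^+ 2 / 2 ^+ k <= 4 * z.
Proof.
move=> z0.
(* This stronger bound is the one that passes from [K] to [K + 1]. *)
suff H : \sum_(k < K) Num.min z (2 ^+ k) ^+ 2 / 2 ^+ k
    <= 4 * Num.min z (2 ^+ K) - 2 * (Num.min z (2 ^+ K) ^+ 2 / 2 ^+ K).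
  apply: le_trans H _.
  have : 0 <= Num.min z (2 ^+ K) ^+ 2 / 2 ^+ K by rewrite divr_ge0 ?sqr_ge0.
  have : Num.min z (2 ^+ K) <= z by rewrite ge_min lexx.
  lra.
elim: K => [|K IH].
  rewrite big_ord0 expr0 divr1.
  have : 0 <= Num.min z 1 by rewrite le_min z0 ler01.
  have : Num.min z 1 <= 1 by rewrite ge_min lexx orbT.
  nra.
rewrite big_ord_recr /=; apply: le_trans (lerD IH (lexx _)) _.
rewrite [2 ^+ K.+1]exprS; set q : R := 2 ^+ K.
have q0 : 0 < q by rewrite exprn_gt0.
have [zq|qz] := leP z q.
  have zq2 : z <= 2 * q by lra.
  rewrite (min_l zq2).
  have -> : z ^+ 2 / (2 * q) = (z ^+ 2 / q) / 2 by field; rewrite ?gt_eqF.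
  by lra.
have [zq|qz2] := leP z (2 * q).
  rewrite -(ler_pM2r q0).
  have -> : (4 * q - 2 * (q ^+ 2 / q) + q ^+ 2 / q) * q = 3 * q ^+ 2.
    by field; rewrite ?gt_eqF.
  have -> : (4 * z - 2 * (z ^+ 2 / (2 * q))) * q = 4 * z * q - z ^+ 2.
    by field; rewrite ?gt_eqF.
  nra.
have -> : (2 * q) ^+ 2 / (2 * q) = 2 * q by field; rewrite ?gt_eqF.
have -> : q ^+ 2 / q = q by field; rewrite ?gt_eqF.
lra.
Qed.

Section Pairwise.
Context d (Omega : measurableType d) (R : realType) (P : probability Omega R).
Context d' (T : measurableType d').
Variables (X : {RV P >-> T}) (Xs : nat -> {RV P >-> T}).
Hypothesis Xs_id : forall i B, measurable B ->
  distribution P (Xs i) B = distribution P X B.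
Hypothesis Xs_ind : forall i j B C, i != j -> measurable B -> measurable C ->
  P (Xs i @^-1` B `&` Xs j @^-1` C) = (P (Xs i @^-1` B) * P (Xs j @^-1` C))%E.

Lemma integral_identical i (f : T -> \bar R) : measurable_fun setT f ->
  (forall x, 0 <= f x)%E ->
  (\int[P]_w f (Xs i w) = \int[P]_w f (X w))%E.
Proof.
move=> mf f0.
rewrite -[LHS](ge0_integral_distribution (Xs i) mf f0).
rewrite -[RHS](ge0_integral_distribution X mf f0).
by apply: eq_measure_integral => B mB _; exact: Xs_id.
Qed.

Let joint i j (w : Omega) := (Xs i w, Xs j w).

Let mjoint i j : measurable_fun setT (joint i j).
Proof. by apply/measurable_fun_pairP; split. Qed.

(** By independence the joint law of two samples is the product of their laws on
    rectangles, hence everywhere, and the Fubini-Tonelli theorem applies. *)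
Lemma integral_pairwise_product i j (h : T -> R) : i != j ->
  measurable_fun setT h -> (forall x, 0 <= h x) ->
  (\int[P]_w (h (Xs i w) * h (Xs j w))%:E =
    (\int[P]_w (h (X w))%:E) * (\int[P]_w (h (X w))%:E))%E.
Proof.
move=> ij mh h0.
pose D := distribution P X.
pose f (z : T * T) := (h z.1 * h z.2)%:E.
have mf : measurable_fun setT f.
  apply/measurable_EFinP; apply: measurable_funM.
    by apply: measurableT_comp => //; exact: measurable_fst.
  by apply: measurableT_comp => //; exact: measurable_snd.
have f0 z : (0 <= f z)%E by rewrite lee_fin mulr_ge0.
have mhE : measurable_fun setT (fun x => (h x)%:E) by exact/measurable_EFinP.
have h0E x : (0 <= (h x)%:E)%E by rewrite lee_fin.
transitivity (\int[pushforward P (joint i j)]_z f z)%E.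
  by rewrite ge0_integral_pushforward//; exact: mjoint.
transitivity (\int[D \x D]_z f z)%E.
  apply: eq_measure_integral => Z mZ _; apply/esym.
  apply: product_measure_unique => // B C mB mC.
  transitivity (P (Xs i @^-1` B `&` Xs j @^-1` C)); first by [].
  by rewrite Xs_ind//; congr (_ * _)%E; exact: Xs_id.
rewrite fubini_tonelli1//.
rewrite -(ge0_integral_distribution X mhE h0E) -/D.
rewrite /fubini_F /f /=.
under eq_integral do under eq_integral do rewrite EFinM.
under eq_integral do rewrite ge0_integralZl//.
rewrite ge0_integralZr//.
exact: integral_ge0.
Qed.
End Pairwise.

Lemma markov_nonneg d (Omega : measurableType d) (R : realType)
    (P : {measure set Omega -> \bar R}) (f : Omega -> R) (c : R) :
  measurable_fun setT f -> (forall w, 0 <= f w) -> 0 <= c ->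
  (c%:E * P [set w | (c <= f w)%R] <= \int[P]_w (f w)%:E)%E.
Proof.
move=> mf f0 c0.
have mA : measurable [set w | c <= f w].
  by rewrite -[X in measurable X]setTI; exact: measurable_fun_le.
rewrite -[in leLHS](setIT [set w | c <= f w]) -integral_indic//.
rewrite -ge0_integralZl//; last first.
  by apply/measurable_EFinP; exact: measurable_indic.
apply: ge0_le_integral => //.
- by move=> w _; rewrite -EFinM lee_fin mulr_ge0.
- by apply: measurable_funeM; exact/measurable_EFinP/measurable_indic.
- exact/measurable_EFinP.
- move=> w _; rewrite -EFinM lee_fin indicE.
  by case: (boolP (w \in _)) => [|_]; [rewrite inE /= mulr1|rewrite mulr0].
Qed.

Lemma borel_cantelli_ae d (Omega : measurableType d) (R : realType)
    (P : {measure set Omega -> \bar R}) (B : nat -> set Omega) :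
  (forall k, measurable (B k)) -> (\sum_(k <oo) P (B k) < +oo)%E ->
  {ae P, forall w, exists k0, forall k, (k0 <= k)%N -> ~ B k w}.
Proof.
move=> mB sB; exists (lim_sup_set B); split.
- by apply: bigcap_measurable => // k _; exact: bigcup_measurable.
- exact: lim_sup_set_cvg0.
- move=> w /= H k _; apply: contrapT => Hk; apply: H.
  by exists k => j kj Bj; apply: Hk; exists j.
Qed.

Section Variance.
Context d (Omega : measurableType d) (R : realType) (P : probability Omega R).
Context d' (T : measurableType d').
Variables (X : {RV P >-> T}) (Xs : nat -> {RV P >-> T}).
Hypothesis Xs_id : forall i B, measurable B ->
  distribution P (Xs i) B = distribution P X B.
Hypothesis Xs_ind : forall i j B C, i != j -> measurable B -> measurable C ->
  P (Xs i @^-1` B `&` Xs j @^-1` C) = (P (Xs i @^-1` B) * P (Xs j @^-1` C))%E.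

(** The variance of a sum of pairwise independent variables. The square is
    expanded with the cross term moved to the left, so that only integrals of
    nonnegative functions occur. *)
Lemma integral_sum_deviation (h : T -> R) (a q : R) (N : nat) :
  measurable_fun setT h -> (forall x, 0 <= h x) ->
  (\int[P]_w (h (X w))%:E = a%:E)%E -> (\int[P]_w (h (X w) ^+ 2)%:E = q%:E)%E ->
  (\int[P]_w ((\sum_(i < N) h (Xs i w) - N%:R * a) ^+ 2)%:E <= (N%:R * q)%:E)%E.
Proof.
move=> mh h0 ha hq.
have a0 : 0 <= a.
  by rewrite -lee_fin -ha; apply: integral_ge0 => w _; rewrite lee_fin.
have mhi i : measurable_fun setT (fun w => h (Xs i w)).
  exact: measurableT_comp.
pose S w := \sum_(i < N) h (Xs i w).
have S0 w : 0 <= S w by apply: sumr_ge0.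
have mS : measurable_fun setT S by apply: measurable_sum => i; exact: mhi.
have ES : (\int[P]_w (S w)%:E = (N%:R * a)%:E)%E.
  under eq_integral do rewrite /S -sumEFin.
  rewrite ge0_integral_sum//; last 2 first.
  - by move=> i; exact/measurable_EFinP.
  - by move=> i w _; rewrite lee_fin.
  have E (i : 'I_N) : (\int[P]_w (h (Xs i w))%:E = a%:E)%E.
    rewrite (integral_identical Xs_id i (f := fun x => (h x)%:E))//.
    exact/measurable_EFinP.
  rewrite (eq_bigr (fun=> a%:E)); last by move=> i _; exact: E.
  by rewrite sumEFin sumr_const card_ord mulr_natl.
have E2 : (\int[P]_w (S w ^+ 2)%:E
    = (N%:R * q + (N%:R ^+ 2 - N%:R) * a ^+ 2)%:E)%E.
  have -> : (\int[P]_w (S w ^+ 2)%:E =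
     \int[P]_w \sum_(i < N) \sum_(j < N) (h (Xs i w) * h (Xs j w))%:E)%E.
    apply: eq_integral => w _; rewrite expr2 /S big_distrlr /= -sumEFin.
    by apply: eq_bigr => i _; rewrite -sumEFin.
  have mhh i j : measurable_fun setT (fun w => (h (Xs i w) * h (Xs j w))%:E).
    by apply/measurable_EFinP; exact: measurable_funM.
  have hh0 i j w : (0 <= (h (Xs i w) * h (Xs j w))%:E)%E.
    by rewrite lee_fin mulr_ge0.
  rewrite ge0_integral_sum//; last 2 first.
  - by move=> i; apply: emeasurable_sum => j; exact: mhh.
  - by move=> i w _; apply: sume_ge0 => j _; exact: hh0.
  have E (i : 'I_N) : (\int[P]_w (\sum_(j < N) (h (Xs i w) * h (Xs j w))%:E)
      = (q + (N%:R - 1) * a ^+ 2)%:E)%E.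
    rewrite ge0_integral_sum//.
    have -> : (q + (N%:R - 1) * a ^+ 2)%:E =
        (\sum_(j < N) (if j == i then q else a ^+ 2)%:E)%E.
      rewrite sumEFin (bigD1 i)//= eqxx; congr (_ + _)%:E.
      rewrite (eq_bigr (fun=> a ^+ 2)); last by move=> j /negbTE ->.
      rewrite sumr_const cardC1 card_ord -[RHS]mulr_natl; congr (_ * _).
      by case: N i {S S0 mS ES} => [[]//|m _]; rewrite /= mulrSr addrK.
    apply: eq_bigr => j _; case: eqP => [->|/eqP ji].
      under eq_integral do rewrite -expr2.
      rewrite (integral_identical Xs_id i (f := fun x => (h x ^+ 2)%:E))//.
      - by apply/measurable_EFinP; exact: measurable_funX.
      - by move=> x; rewrite lee_fin sqr_ge0.
    rewrite (integral_pairwise_product Xs_id Xs_ind)//; last first.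
      by rewrite eq_sym; exact: ji.
    by rewrite ha -EFinM expr2.
  rewrite (eq_bigr (fun=> (q + (N%:R - 1) * a ^+ 2)%:E)); last by move=> i _; exact: E.
  by rewrite sumEFin sumr_const card_ord; congr EFin; ring.
have H : (\int[P]_w ((S w - N%:R * a) ^+ 2)%:E + (2 * N%:R * a)%:E * (N%:R * a)%:E
    = (N%:R * q + (N%:R ^+ 2 - N%:R) * a ^+ 2)%:E + (N%:R ^+ 2 * a ^+ 2)%:E)%E.
  rewrite -E2 -ES -ge0_integralZl//; last 3 first.
  - exact/measurable_EFinP.
  - by move=> w _; rewrite lee_fin.
  - by rewrite lee_fin !mulr_ge0.
  have -> : (N%:R ^+ 2 * a ^+ 2)%:E = (\int[P]_w (cst (N%:R ^+ 2 * a ^+ 2)%:E w))%E.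
    by rewrite integral_cst// [X in (_ * X)%E](probability_setT P) mule1.
  rewrite -ge0_integralD//; last 4 first.
  - by move=> w _; rewrite lee_fin sqr_ge0.
  - apply/measurable_EFinP; apply: measurable_funX.
    by apply: measurable_funB.
  - by move=> w _; rewrite -EFinM lee_fin !mulr_ge0.
  - by apply: measurable_funeM; exact/measurable_EFinP.
  rewrite -ge0_integralD//; last 3 first.
  - by move=> w _; rewrite lee_fin sqr_ge0.
  - by apply/measurable_EFinP; exact: measurable_funX.
  - by move=> w _; rewrite lee_fin mulr_ge0 ?sqr_ge0.
  apply: eq_integral => w _; rewrite -!EFinM -!EFinD; congr EFin; ring.
have : (\int[P]_w ((S w - N%:R * a) ^+ 2)%:E =
    (N%:R * q - N%:R * a ^+ 2)%:E)%E.
  move: H; set V := (\int[P]_w _)%E; rewrite -EFinM -EFinD.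
  case: V => [v| |]//; rewrite -EFinD => -[H]; congr EFin.
  apply: (addIr (2 * N%:R * a * (N%:R * a))); rewrite H; ring.
rewrite /S => ->; rewrite lee_fin lerBlDr lerDl mulr_ge0// sqr_ge0//.
Qed.

Lemma chebyshev_sum (h : T -> R) (a q c : R) (N : nat) :
  measurable_fun setT h -> (forall x, 0 <= h x) ->
  (\int[P]_w (h (X w))%:E = a%:E)%E -> (\int[P]_w (h (X w) ^+ 2)%:E = q%:E)%E ->
  (0 < N)%N -> 0 < c ->
  (P [set w | ((N%:R * c) ^+ 2 <= (\sum_(i < N) h (Xs i w) - N%:R * a) ^+ 2)%R]
    <= (q / (N%:R * c ^+ 2))%:E)%E.
Proof.
move=> mh h0 ha hq N0 c0.
have NR : 0 < N%:R :> R by rewrite ltr0n.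
have c20 : 0 < (N%:R * c) ^+ 2 by rewrite exprn_gt0// mulr_gt0.
have -> : q / (N%:R * c ^+ 2) = (N%:R * q) / (N%:R * c) ^+ 2.
  by field; rewrite !gt_eqF.
rewrite EFinM muleC lee_pdivlMl//.
apply: le_trans (integral_sum_deviation N mh h0 ha hq).
apply: markov_nonneg => [|w|].
- apply: measurable_funX; apply: measurable_funB => //.
  by apply: measurable_sum => i; exact: measurableT_comp.
- exact: sqr_ge0.
- exact: ltW.
Qed.
End Variance.

(** * Averages along almost every sample *)

Lemma measurable_set_ge d (Omega : measurableType d) (R : realType)
    (f : Omega -> R) (c : R) :
  measurable_fun setT f -> measurable [set w | c <= f w].
Proof.
by move=> mf; rewrite -[X in measurable X]setTI; exact: measurable_fun_le.
Qed.

Lemma norm_lt_of_sqr (R : realType) (c x : R) : 0 <= c ->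
  ~ (c ^+ 2 <= x ^+ 2) -> `|x| < c.
Proof.
by move=> c0 /negP; rewrite -ltNge -[x ^+ 2]real_normK ?num_real// ltr_sqr//.
Qed.

Lemma dyadic_bracket (n : nat) : (0 < n)%N -> exists2 k, (2 ^ k <= n)%N & (n < 2 ^ k.+1)%N.
Proof. by move=> n0; exists (trunc_log 2 n); [exact: trunc_logP|exact: trunc_log_ltn]. Qed.

Section Averages.
Context d (Omega : measurableType d) (R : realType) (P : probability Omega R).
Context d' (T : measurableType d').
Variables (X : {RV P >-> T}) (Xs : nat -> {RV P >-> T}).
Hypothesis Xs_id : forall i B, measurable B ->
  distribution P (Xs i) B = distribution P X B.
Hypothesis Xs_ind : forall i j B C, i != j -> measurable B -> measurable C ->
  P (Xs i @^-1` B `&` Xs j @^-1` C) = (P (Xs i @^-1` B) * P (Xs j @^-1` C))%E.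

Lemma integral_bounded (f : T -> R) (b : R) : measurable_fun setT f ->
  (forall x, 0 <= f x <= b) -> exists a : R, (\int[P]_w (f (X w))%:E = a%:E)%E.
Proof.
move=> mf fb; have I0 : (0 <= \int[P]_w (f (X w))%:E)%E.
  by apply: integral_ge0 => w _; rewrite lee_fin; case/andP: (fb (X w)).
have Ib : (\int[P]_w (f (X w))%:E <= b%:E)%E.
  apply: (@le_trans _ _ (\int[P]_w (cst b%:E w))%E).
    apply: ge0_le_integral => //.
    - by move=> w _; rewrite lee_fin; case/andP: (fb (X w)).
    - by apply/measurable_EFinP; exact: measurableT_comp.
    - by move=> w _; rewrite lee_fin; case/andP: (fb (X w)).
  by rewrite integral_cst// [X in (_ * X)%E](probability_setT P) mule1.
exists (fine (\int[P]_w (f (X w))%:E)); rewrite fineK// ge0_fin_numE//.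
exact: le_lt_trans Ib (ltry _).
Qed.

Lemma dyadic_series_integral (Z : T -> R) : measurable_fun setT Z ->
  (forall x, 0 <= Z x) ->
  (\sum_(k <oo) \int[P]_w (Num.min (Z (X w)) (2 ^+ k) ^+ 2 / 2 ^+ k)%:E
    <= 4%:E * \int[P]_w (Z (X w))%:E)%E.
Proof.
move=> mZ Z0.
have mk k : measurable_fun setT
    (fun w => (Num.min (Z (X w)) (2 ^+ k) ^+ 2 / 2 ^+ k)%:E).
  apply/measurable_EFinP; apply: measurable_funM => //; apply: measurable_funX.
  by apply: measurable_minr => //; exact: measurableT_comp.
have k0 k w : (0 <= (Num.min (Z (X w)) (2 ^+ k) ^+ 2 / 2 ^+ k)%:E)%E.
  by rewrite lee_fin divr_ge0 ?sqr_ge0.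
rewrite -integral_nneseries//.
have mZE : measurable_fun setT (fun w => (Z (X w))%:E).
  by apply/measurable_EFinP; exact: measurableT_comp.
rewrite -ge0_integralZl//; last by move=> w _; rewrite lee_fin.
apply: ge0_le_integral => //.
- by move=> w _; exact: nneseries_ge0.
- exact: ge0_emeasurable_sum.
- by apply: measurable_funeM.
- move=> w _; apply: lime_le; first exact: is_cvg_nneseries.
  apply: nearW => K; rewrite big_mkord sumEFin lee_fin.
  exact: min_square_dyadic_sum.
Qed.

(** The part of the strong law of large numbers that is needed: the averages of
    identically distributed, pairwise independent, nonnegative integrable
    variables are almost surely bounded. For the first [2 ^ k] samples,
    truncate [Z] at [2 ^+ k]: the probability that some truncation is
    effective, and the probability that the truncated sum deviates by more
    than [2 ^+ k] from its mean, are both at most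
    [E (min Z (2 ^+ k)) ^+ 2 / 2 ^+ k], which is summable in [k] by
    [dyadic_series_integral]. By Borel-Cantelli the bound holds for all large
    powers of 2, and by monotonicity of the sums, up to a factor 2, for all
    large [n]. *)
Lemma eventually_average_le (Z : T -> R) : measurable_fun setT Z ->
  (forall x, 0 <= Z x) -> (\int[P]_w (Z (X w))%:E < +oo)%E ->
  exists C : R, {ae P, forall w, exists n0, forall n, (n0 <= n)%N ->
    \sum_(i < n) Z (Xs i w) <= C * n%:R}.
Proof.
move=> mZ Z0 Zoo.
pose h k x := Num.min (Z x) (2 ^+ k) : R.
have mh k : measurable_fun setT (h k) by exact: measurable_minr.
have h0 k x : 0 <= h k x by rewrite le_min Z0 exprn_ge0.
have hk k x : h k x <= 2 ^+ k by rewrite ge_min lexx orbT.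
have /choice[a aE] : forall k, exists a : R, (\int[P]_w (h k (X w))%:E = a%:E)%E.
  by move=> k; apply: (@integral_bounded _ (2 ^+ k)) => // x; rewrite h0 hk.
have /choice[q qE] : forall k, exists q : R, (\int[P]_w (h k (X w) ^+ 2)%:E = q%:E)%E.
  move=> k; apply: (@integral_bounded (fun x => h k x ^+ 2) ((2 ^+ k) ^+ 2)).
    exact: measurable_funX.
  by move=> x; rewrite sqr_ge0 ler_pXn2r ?nnegrE ?h0 ?hk ?exprn_ge0.
pose m := fine (\int[P]_w (Z (X w))%:E)%E.
have mE : (\int[P]_w (Z (X w))%:E = m%:E)%E.
  by rewrite fineK// ge0_fin_numE//; apply: integral_ge0 => w _; rewrite lee_fin.
have am k : a k <= m.
  rewrite -lee_fin -aE -mE; apply: ge0_le_integral => //.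
  - by move=> w _; rewrite lee_fin.
  - by apply/measurable_EFinP; exact: measurableT_comp.
  - by apply/measurable_EFinP; exact: measurableT_comp.
  - by move=> w _; rewrite lee_fin ge_min lexx.
(* [D k]: large deviation of the truncated sum, with margin [c = 1] in
   [chebyshev_sum]; [F k i]: the truncation is effective on the sample [i]. *)
pose D k := [set w | (((2 ^ k)%N%:R * 1) ^+ 2
  <= (\sum_(i < 2 ^ k) h k (Xs i w) - (2 ^ k)%N%:R * a k) ^+ 2)%R].
pose F k i := [set w | ((2 ^+ k) ^+ 2 <= h k (Xs i w) ^+ 2)%R].
pose B k := D k `|` \big[setU/set0]_(i < 2 ^ k) F k i.
have mD k : measurable (D k).
  apply: measurable_set_ge; apply: measurable_funX; apply: measurable_funB => //.
  by apply: measurable_sum => i; exact: measurableT_comp.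
have mF k i : measurable (F k i).
  by apply: measurable_set_ge; apply: measurable_funX; exact: measurableT_comp.
have mB k : measurable (B k).
  by apply: measurableU => //; exact: bigsetU_measurable.
have PD k : (P (D k) <= (q k / 2 ^+ k)%:E)%E.
  have -> : q k / 2 ^+ k = q k / ((2 ^ k)%N%:R * 1 ^+ 2).
    by rewrite expr1n mulr1 natrX.
  apply: (chebyshev_sum Xs_id Xs_ind (mh k) (h0 k) (aE k) (qE k)) => //.
  by rewrite expn_gt0.
have PF k i : (P (F k i) <= (q k / (2 ^+ k) ^+ 2)%:E)%E.
  have p0 : 0 < (2 ^+ k) ^+ 2 :> R by rewrite !exprn_gt0.
  rewrite EFinM muleC lee_pdivlMl//.
  have <- : (\int[P]_w (h k (Xs i w) ^+ 2)%:E = (q k)%:E)%E.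
    rewrite -qE (integral_identical Xs_id i (f := fun x => (h k x ^+ 2)%:E))//.
      by apply/measurable_EFinP; exact: measurable_funX.
    by move=> x; rewrite lee_fin sqr_ge0.
  apply: markov_nonneg; [|by move=> w; exact: sqr_ge0|exact: ltW].
  by apply: measurable_funX; exact: measurableT_comp.
have PB k : (P (B k) <= (2 * (q k / 2 ^+ k))%:E)%E.
  apply: le_trans (measureU2 _ _ _) _ => //; first exact: bigsetU_measurable.
  have -> : 2 * (q k / 2 ^+ k) = q k / 2 ^+ k + q k / 2 ^+ k by ring.
  rewrite EFinD; apply: leeD; first exact: PD.
  apply: le_trans (Boole_inequality _ _) _; first by move=> i _; exact: mF.
  apply: (@le_trans _ _ (\sum_(i < 2 ^ k) (q k / (2 ^+ k) ^+ 2)%:E)%E).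
    by apply: lee_sum => i _; exact: PF.
  rewrite sumEFin sumr_const card_ord lee_fin -[leLHS]mulr_natl natrX.
  by rewrite le_eqVlt; apply/orP; left; apply/eqP; field.
have BC : {ae P, forall w, exists k0, forall k, (k0 <= k)%N -> ~ B k w}.
  apply: borel_cantelli_ae => //.
  apply: (@le_lt_trans _ _ (\sum_(k <oo) (2%:E *
      \int[P]_w (Num.min (Z (X w)) (2 ^+ k) ^+ 2 / 2 ^+ k)%:E))%E).
    apply: lee_nneseries => // k _; apply: le_trans (PB k) _.
    rewrite EFinM; apply: lee_wpmul2l => //.
    under eq_integral do rewrite EFinM muleC.
    rewrite ge0_integralZl//; last 2 first.
    - apply/measurable_EFinP; apply: measurable_funX.
      by apply: (measurableT_comp (mh k)).
    - by move=> w _; rewrite lee_fin sqr_ge0.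
    by rewrite [X in (_ * X)%E](qE k) muleC EFinM.
  rewrite nneseriesZl; last first.
    move=> k _; apply: integral_ge0 => w _.
    by rewrite lee_fin divr_ge0 ?sqr_ge0.
  apply: (@le_lt_trans _ _ (2%:E * (4%:E * m%:E))%E); last by rewrite ltry.
  by rewrite -mE lee_pmul2l//; exact: dyadic_series_integral.
exists (2 * (m + 1)).
apply: filterS BC => w [k0 Bk].
have m0 : 0 <= m by rewrite -lee_fin -mE; apply: integral_ge0 => w' _; rewrite lee_fin.
have dyad k : (k0 <= k)%N -> \sum_(i < 2 ^ k) Z (Xs i w) <= 2 ^+ k * (m + 1).
  move=> /Bk nB.
  have ZE (i : 'I_(2 ^ k)) : Z (Xs i w) = h k (Xs i w).
    have /norm_lt_of_sqr : ~ F k i w.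
      by move=> Fi; apply: nB; right; rewrite -bigcup_mkord; exists i => //=.
    rewrite exprn_ge0// => /(_ isT); rewrite ger0_norm// /h.
    by case: (leP (Z (Xs i w))) => // _; rewrite ltxx.
  rewrite (eq_bigr (fun i : 'I_(2 ^ k) => h k (Xs i w))) => [|i _]; last exact: ZE.
  have /norm_lt_of_sqr : ~ D k w by move=> Dk; apply: nB; left.
  rewrite mulr1 ler0n => /(_ isT); rewrite natrX => /(le_lt_trans (ler_norm _)).
  have := am k; have : 0 <= 2 ^+ k :> R by rewrite exprn_ge0.
  nra.
exists (2 ^ k0)%N => n kn.
have n0 : (0 < n)%N by apply: leq_trans kn; rewrite expn_gt0.
have [k nk1 nk2] := dyadic_bracket n0.
have k0k : (k0 <= k.+1)%N.
  by rewrite -(leq_exp2l _ _ (ltnSn 1)); exact: leq_trans kn (ltnW nk2).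
apply: (@le_trans _ _ (\sum_(i < 2 ^ k.+1) Z (Xs i w))).
  rewrite -(big_mkord xpredT (fun i => Z (Xs i w))).
  rewrite -(big_mkord xpredT (fun i => Z (Xs i w))).
  rewrite [leRHS](@big_cat_nat _ _ _ n)//=; last exact: ltnW.
  by rewrite lerDl; apply: sumr_ge0.
apply: le_trans (dyad _ k0k) _.
have nk : 2 ^+ k <= n%:R :> R by rewrite -natrX ler_nat.
rewrite exprS; nra.
Qed.

(** An event of positive probability occurs with positive frequency: Chebyshev's
    inequality and Borel-Cantelli along the powers of 2, then monotonicity. *)
Lemma eventually_frequency_ge (K : set T) : measurable K ->
  (0 < P (X @^-1` K))%E ->
  exists2 c : R, 0 < c & {ae P, forall w, exists n0, forall n, (n0 <= n)%N ->
    c * n%:R <= \sum_(i < n) \1_K (Xs i w)}.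
Proof.
move=> mK PK.
pose h x := \1_K x : R.
have mh : measurable_fun setT h by exact: measurable_indic.
have h0 x : 0 <= h x by rewrite /h indicE.
pose a := fine (P (X @^-1` K)).
have hX : (\int[P]_w (h (X w))%:E = a%:E)%E.
  have mXK : measurable (X @^-1` K) by exact: measurable_sfunP.
  rewrite (_ : (fun w => _) = (fun w => (\1_(X @^-1` K) w)%:E))//.
  by rewrite integral_indic// setIT fineK// fin_num_measure.
have a0 : 0 < a.
  by rewrite -lte_fin fineK// fin_num_measure//; exact: measurable_sfunP.
have hX2 : (\int[P]_w (h (X w) ^+ 2)%:E = a%:E)%E.
  rewrite -hX; apply: eq_integral => w _; congr EFin.
  by rewrite /h indicE; case: (_ \in _); rewrite ?expr1n ?expr0n.
pose c := a / 2.
have c0 : 0 < c by rewrite divr_gt0.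
pose D k := [set w | (((2 ^ k)%N%:R * c) ^+ 2
  <= (\sum_(i < 2 ^ k) h (Xs i w) - (2 ^ k)%N%:R * a) ^+ 2)%R].
have mD k : measurable (D k).
  apply: measurable_set_ge; apply: measurable_funX; apply: measurable_funB => //.
  by apply: measurable_sum => i; exact: measurableT_comp.
have PD k : (P (D k) <= (a / c ^+ 2)%:E * (1 / 2 ^+ k)%:E)%E.
  have N0 : (0 < 2 ^ k)%N by rewrite expn_gt0.
  apply: le_trans (chebyshev_sum Xs_id Xs_ind mh h0 hX hX2 N0 c0) _.
  rewrite -EFinM lee_fin natrX.
  by rewrite le_eqVlt; apply/orP; left; apply/eqP; field; rewrite ?gt_eqF ?exprn_gt0.
have BC : {ae P, forall w, exists k0, forall k, (k0 <= k)%N -> ~ D k w}.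
  apply: borel_cantelli_ae => //.
  apply: (@le_lt_trans _ _ (\sum_(k <oo) ((a / c ^+ 2)%:E * (1 / 2 ^+ k)%:E))%E).
    by apply: lee_nneseries => // k _; exact: PD.
  rewrite nneseriesZl; last by move=> k _; rewrite lee_fin.
  apply: (@le_lt_trans _ _ ((a / c ^+ 2)%:E * 4%:E)%E); last by rewrite -EFinM ltry.
  apply: lee_wpmul2l; first by rewrite lee_fin divr_ge0 ?exprn_ge0 ?ltW.
  apply: lime_le; first by apply: is_cvg_nneseries.
  apply: nearW => K'; rewrite big_mkord sumEFin lee_fin.
  (* For [z = 1] the dyadic sum is the geometric series. *)
  have := @min_square_dyadic_sum R 1 K' ler01; rewrite mulr1; apply: le_trans.
  apply: ler_sum => k _; rewrite min_l ?expr1n//.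
  by rewrite -natrX ler1n expn_gt0.
exists (c / 2); first by rewrite divr_gt0.
apply: filterS BC => w [k0 Bk].
have dyad k : (k0 <= k)%N -> 2 ^+ k * c <= \sum_(i < 2 ^ k) h (Xs i w).
  have p0 : 0 <= (2 ^ k)%N%:R * c by rewrite mulr_ge0// ltW.
  move=> /Bk /(norm_lt_of_sqr p0).
  by rewrite ltr_norml natrX => /andP[+ _]; rewrite /c; lra.
exists (2 ^ k0)%N => n kn.
have n0 : (0 < n)%N by apply: leq_trans kn; rewrite expn_gt0.
have [k nk1 nk2] := dyadic_bracket n0.
have k0k : (k0 <= k)%N.
  by rewrite -ltnS -(ltn_exp2l _ _ (ltnSn 1)); exact: leq_ltn_trans kn nk2.
apply: (@le_trans _ _ (\sum_(i < 2 ^ k) h (Xs i w))); last first.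
  rewrite -(big_mkord xpredT (fun i => h (Xs i w))).
  rewrite -(big_mkord xpredT (fun i => \1_K (Xs i w))).
  rewrite [leRHS](@big_cat_nat _ _ _ (2 ^ k))//=.
  by rewrite lerDl; apply: sumr_ge0.
apply: le_trans (dyad _ k0k).
have nk : n%:R <= 2 ^+ k.+1 :> R by rewrite -natrX ler_nat ltnW.
move: nk; rewrite exprS; nra.
Qed.
End Averages.

(** * Consistency of the estimator *)

Section Compactness.
Variables (R : realType) (n : nat) (M : ptopologicalType).
Variables (A : smooth_atlas R n M) (g : riemannian_metric A).

(** The deterministic part of the argument, for one sample [w]. If the
    conclusion fails, there are points [y j] of later and later estimators
    outside [B(E, eps)]. They have no cluster point: it would lie in [E], and
    the ball around it would catch some [y j]. So every set of such points is
    closed; if their distance to [y0] were bounded, the Heine-Borel property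
    would give a cluster point. Hence a subsequence goes to infinity, which is
    excluded by hypothesis. *)
Lemma tail_union_sub_ball_around d (Omega : measurableType d) (E : set M) (En : nat -> Omega -> set M)
    (w : Omega) (y0 : M) (eps : R) :
  hausdorff_space M -> 0 < eps ->
  \bigcap_(k0 in [set k0 | (1 <= k0)%N]) closure (tail_union En k0 w) `<=` E ->
  (forall B : set M, B `<=` closure (tail_union En 1 w) -> closed B ->
    bounded_subset g B -> compact B) ->
  (forall (y : nat -> M) (k : nat -> nat), (forall j, (j < k j)%N) ->
    (forall j, En (k j) w (y j)) ->
    ~ geodesic_distance g y0 (y j) @[j --> \oo] --> +oo%E) ->
  exists2 k0 : nat, (0 < k0)%N & tail_union En k0 w `<=` ball_around g E eps.
Proof.
move=> hM eps0 zE HB noesc; apply: contrapT => bad.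
have /choice[z zP] : forall j, exists z : nat * M,
    [/\ (j < z.1)%N, En z.1 w z.2 & ~ ball_around g E eps z.2].
  move=> j; apply: contrapT => nz; apply: bad; exists j.+1 => // x [k jk kx].
  by apply: contrapT => xE; apply: nz; exists (k, x).
pose k j := (z j).1; pose y j := (z j).2.
have jk j : (j < k j)%N by have [] := zP j.
have ky j : En (k j) w (y j) by have [] := zP j.
have yE j : ~ ball_around g E eps (y j) by have [] := zP j.
have ytail k0 j : (k0 <= j)%N -> tail_union En k0 w (y j).
  by move=> k0j; exists (k j) => //=; exact: leq_trans k0j (ltnW (jk j)).
have nocluster (x : M) : exists2 U, nbhs x U & exists m, forall j, (m <= j)%N -> ~ U (y j).
  apply: contrapT => cl.
  have clP U m : nbhs x U -> exists2 j, (m <= j)%N & U (y j).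
    move=> xU; apply: contrapT => nj; apply: cl; exists U => //; exists m => j mj Uj.
    by apply: nj; exists j.
  have xE : E x.
    apply: zE => k0 _ U xU; have [j k0j Uj] := clP U k0 xU.
    by exists (y j); split => //; exact: ytail.
  have [j _ dj] := clP _ 0%N (near_geodesic_distance_lt g x eps0).
  by apply: (yE j); exists x.
have [m dm] : exists m : nat, forall j, (m <= j)%N ->
    (geodesic_distance g y0 (y j) < m%:R%:E)%E.
  apply: contrapT => ub.
  have /choice[s sP] : forall m : nat, exists j, (m <= j)%N /\
      (m%:R%:E <= geodesic_distance g y0 (y j))%E.
    move=> m; apply: contrapT => nm; apply: ub; exists m => j mj.
    by rewrite ltNge; apply/negP => dj; apply: nm; exists j.
  apply: (noesc (y \o s) (k \o s)) => [j|j|]; [|exact: ky|].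
    by apply: leq_ltn_trans (jk (s j)); case: (sP j).
  apply/cvgeyPge => a; near=> j.
  apply: le_trans (sP j).2; rewrite lee_fin.
  by near: j; exact: nbhs_infty_ger.
pose B := [set y j | j in [set j | (m <= j)%N]].
have clB : closed B.
  move=> x xB; have [U xU [m' m'U]] := nocluster x.
  apply: contrapT => xNB.
  pose F := [set y j | j in `I_m'] `&` B.
  have cF : closed F.
    apply: (accessible_finite_set_closed.1 (hausdorff_accessible hM)).
    by apply: finite_setIl; apply: finite_image; exact: finite_II.
  have xF : nbhs x (~` F).
    by apply: open_nbhs_nbhs; split; [exact: closed_openC|move=> [_ /xNB]].
  have [v [Bv [Uv Fv]]] := xB _ (filterI xU xF).
  have [j mj jv] := Bv; apply: Fv; split=> //; exists j => //=.
  by rewrite ltnNge; apply/negP => /m'U; apply; rewrite jv.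
have bB : bounded_subset g B.
  exists (m%:R + m%:R) => _ _ [i mi <-] [j mj <-]; apply: ltW.
  by apply: (@geodesic_distance_triangle _ _ _ _ g _ y0);
    [rewrite geodesic_distance_sym|]; exact: dm.
have BT : B `<=` closure (tail_union En 1 w).
  move=> _ [j _ <-]; apply: subset_closure.
  by exists (k j) => //=; exact: leq_ltn_trans (jk j).
have yB : \forall j \near \oo, B (y j).
  by exists m => // j /= mj; exists j.
have [x [_ xcl]] := HB B BT clB bB (y @ \oo) _ yB.
have [U xU [m' m'U]] := nocluster x.
have yt : (y @ \oo) [set y j | j in [set j | (m' <= j)%N]].
  by exists m' => // j /= m'j; exists j.
by have [_ [[j m'j <-] Uj]] := xcl _ _ yt xU; apply: (m'U j).
Unshelve. all: by end_near. Qed.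
End Compactness.

Lemma continuous_borel_measurable (R : realType) (M : ptopologicalType)
    (f : M -> R) : continuous f -> measurable_fun [set: borel M] f.
Proof.
move=> /continuousP cf; apply: (@measurability _ _ (borel M) (measurableTypeR R) setT f _ (@RGenOpens.measurableE R)).
move=> _ [_ [a [b ->]] <-]; rewrite setTI.
by apply: sub_sigma_algebra; apply: cf; exact: interval_open.
Qed.

(** The integral of [f] being less than +oo allows a priori for +oo - +oo; the
    lower bound on [f] makes its negative part integrable. *)
Lemma integral_shift_lty d (Omega : measurableType d) (R : realType)
    (P : probability Omega R) (f : Omega -> R) (L : R) :
  measurable_fun setT f -> (forall w, 0 <= f w + L) ->
  (\int[P]_w (f w)%:E < +oo)%E -> (\int[P]_w (f w + L)%:E < +oo)%E.
Proof.
move=> mf fL; rewrite integralE => foo.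
pose f' := EFin \o f.
have mf' : measurable_fun setT f' by exact/measurable_EFinP.
have mcst (c : R) : (\int[P]_w (cst c%:E w) = c%:E)%E.
  by rewrite integral_cst// [X in (_ * X)%E](probability_setT P) mule1.
have In : (\int[P]_w (f'^\- w) <= `|L|%:E)%E.
  rewrite -mcst; apply: ge0_le_integral => //.
  - exact: measurable_funeneg.
  - move=> w _; rewrite funenegE /f' /= -EFin_max lee_fin ge_max normr_ge0 andbT.
    by have := fL w; have := ler_norm L; lra.
have Ip : (\int[P]_w (f'^\+ w) < +oo)%E.
  move: foo In; rewrite -/f' /=.
  have : (0 <= \int[P]_w (f'^\- w))%E by exact: integral_ge0.
  case: (\int[P]_w (f'^\+ w))%E => [r _ _ _| |]; first exact: ltry.
    by case: (\int[P]_w (f'^\- w))%E => [r| |] //=.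
  by move=> _ _ _; rewrite ltNye.
apply: (@le_lt_trans _ _ (\int[P]_w (f'^\+ w + cst `|L|%:E w))%E).
  apply: ge0_le_integral => //.
  - by move=> w _; rewrite lee_fin.
  - by apply/measurable_EFinP; exact: measurable_funD.
  - by apply: emeasurable_funD => //; exact: measurable_funepos.
  - move=> w _; rewrite funeposE /f' /= -EFin_max -EFinD lee_fin.
    by rewrite lerD ?ler_norm// le_max lexx.
rewrite ge0_integralD//; [|exact: measurable_funepos|by move=> w _; rewrite lee_fin].
by rewrite mcst lte_add_pinfty// ltry.
Qed.

Section Objective.
Variables (R : realType) (n : nat) (M : ptopologicalType).
Variables (A : smooth_atlas R n M) (g : riemannian_metric A).
Variables (p : M -> M -> R -> R) (t : R).
Variables (d : measure_display) (Omega : measurableType d).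
Variable (P : probability Omega R).
Variable Xs : nat -> {RV P >-> borel M}.

(** Estimators cannot escape to infinity. A fixed competitor [z] keeps the
    minimum of the empirical objective, shifted by [L], below [a]. At a point [y j] far away each sample in the set
    [- ln (p x y0 t) < C], of frequency at least [c], contributes more than
    [r j], and the others at least [- L]; as [r j] tends to infinity the
    objective would exceed [a]. *)
Lemma estimator_no_escape (w : Omega) (y0 z : M) (C L a c : R) n1 n2 :
  (forall x y, - L <= - ln (p x y t)) ->
  (forall y : nat -> M,
     geodesic_distance g y0 (y k) @[k --> \oo] --> +oo%E ->
     exists2 r : nat -> R, r k @[k --> \oo] --> +oo &
       forall k x, - ln (p x y0 t) < C -> r k < - ln (p x (y k) t)) ->
  0 < c ->
  (forall k, (n1 <= k)%N -> \sum_(i < k) (- ln (p (Xs i w) z t) + L) <= a * k%:R) ->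
  (forall k, (n2 <= k)%N -> c * k%:R <=
    \sum_(i < k) \1_[set x | - ln (p x y0 t) < C] (Xs i w)) ->
  forall (y : nat -> M) (k : nat -> nat), (forall j, (j < k j)%N) ->
    (forall j, diffusion_estimator p t Xs (k j) w (y j)) ->
    ~ geodesic_distance g y0 (y j) @[j --> \oo] --> +oo%E.
Proof.
move=> pL coer c0 az cK y k jk ky /coer[r roo rP].
have [j [n1j n2j rj0 rja]] : exists j, [/\ (n1 <= j)%N, (n2 <= j)%N, - L <= r j &
    a / c - L < r j].
  near \oo => j; exists j; split.
  - by near: j; exact: nbhs_infty_ge.
  - by near: j; exact: nbhs_infty_ge.
  - by near: j; move/cvgryPge : roo; exact.
  - by near: j; move/cvgryPgt : roo; exact.
set m := k j.
have m0 : (0 < m)%N by exact: leq_ltn_trans (jk j).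
have mR : 0 < m%:R :> R by rewrite ltr0n.
have jm : (j <= m)%N by exact: ltnW.
have H1 := az m (leq_trans n1j jm).
have H2 := cK m (leq_trans n2j jm).
have H3 : \sum_(i < m) (- ln (p (Xs i w) (y j) t) + L)
    <= \sum_(i < m) (- ln (p (Xs i w) z t) + L).
  have /= := ky j z; rewrite lerN2 -/m => H.
  rewrite !big_split /= lerD2r !sumrN lerN2.
  by move: H; rewrite ler_pM2l// invr_gt0.
have H4 : (r j + L) * \sum_(i < m) \1_[set x | - ln (p x y0 t) < C] (Xs i w)
    <= \sum_(i < m) (- ln (p (Xs i w) (y j) t) + L).
  rewrite mulr_sumr; apply: ler_sum => i _; rewrite indicE.
  case: (boolP (_ \in _)) => [|_]; last first.
    by rewrite mulr0 -lerBlDr sub0r; exact: pL.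
  by rewrite inE /= mulr1 lerD2r => /rP/ltW.
have : (r j + L) * (c * m%:R) <= a * m%:R.
  apply: le_trans (ler_wpM2l _ H2) _; first by rewrite -lerBlDr sub0r.
  by apply: le_trans H4 _; apply: le_trans H3 H1.
rewrite mulrA ler_pM2r// => H5.
have : a < (r j + L) * c by rewrite -ltr_pdivrMr// -ltrBlDr.
by rewrite ltNge H5.
Unshelve. all: by end_near. Qed.
End Objective.

Theorem lemma4p3 (R : realType) (n : nat) (M : ptopologicalType)
  (A : smooth_atlas R n M) (g : riemannian_metric A)
  (vol : {measure set (borel M) -> \bar R})
  (p : M -> M -> R -> R)
  (d : measure_display) (Omega : measurableType d) (P : probability Omega R)
  (X : {RV P >-> borel M}) (Xs : nat -> {RV P >-> borel M}) (t : R)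
  (M_hausdorff : hausdorff_space M)
  (M_second_countable : @second_countable M)
  (M_connected : connected [set: M])
  (g_complete : geodesically_complete g)
  (g_curvature : bounded_sectional_curvature g)
  (vol_g : riemannian_volume g vol)
  (p_heat : minimal_heat_kernel g vol p)
  (p_stochastic : stochastically_complete vol p)
  (p_bounded : forall s : R, 0 < s -> exists B : R, forall x y, p x y s <= B)
  (t_gt0 : 0 < t)
  (Xs_iid : iid_samples X Xs)
  (mean_nonempty : diffusion_mean_set p t X !=set0)
  (ziezold : ziezold_consistent P (diffusion_mean_set p t X)
     (diffusion_estimator p t Xs))
  (heine_borel : heine_borel_property g P (diffusion_estimator p t Xs))
  (coercive : exists (y0 : M) (C : R),
     [/\ 0 < C,
         (0 < P [set w | - ln (p (X w) y0 t) < C]%R)%E &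
         forall y : nat -> M,
           geodesic_distance g y0 (y k) @[k --> \oo] --> +oo%E ->
           exists2 r : nat -> R, r k @[k --> \oo] --> +oo &
             forall k x, - ln (p x y0 t) < C -> r k < - ln (p x (y k) t)]) :
  bhattacharya_patrangenaru_consistent g P (diffusion_mean_set p t X)
    (diffusion_estimator p t Xs).
Proof.
split=> // eps eps0.
have p0 x y : 0 < p x y t by have [[+ _ _ _ _] _] := p_heat y; apply.
have pc y : continuous (fun x => - ln (p x y t)).
  move=> x.
  have [[_ + _ _ _] _] := p_heat y => /(_ x t t_gt0) pxt.
  have pcx : {for x, continuous (fun x' => p x' y t)}.
    apply: (@continuous_comp _ _ _ (fun x' => (x', t)) (fun z => p z.1 y z.2)) => //.
    exact: (cvg_pair cvg_id (cvg_cst t)).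
  have lcx : {for x, continuous (fun x' => ln (p x' y t))}.
    by apply: (@continuous_comp _ _ _ (fun x' => p x' y t) (@ln R));
      [exact: pcx|exact: continuous_ln].
  exact: (continuousN lcx).
have mp y : measurable_fun [set: borel M] (fun x => - ln (p x y t)).
  exact: continuous_borel_measurable.
have [b pb] := p_bounded t t_gt0.
have b0 : 0 < b := lt_le_trans (p0 point point) (pb point point).
have pL x y : - ln b <= - ln (p x y t).
  by rewrite lerN2 ler_ln// posrE.
have [z zmin] := mean_nonempty.
(* If the minimal value is infinite, every point is a minimizer. *)
have [Ez|Ez] := eqVneq ('E_P[fun w => (- ln (p (X w) z t))%R])%E +oo%E.
  have EM y : diffusion_mean_set p t X y.
    by move=> y'; apply: le_trans (zmin y'); rewrite Ez leey.
  apply: aeW => w; exists 1%N => // y _; exists y; first exact: EM.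
  by apply: le_lt_trans (geodesic_distance_le (path_nil g y)) _; rewrite lte_fin.
have [Xid Xind] := Xs_iid.
have Xs_ind i j (B C : set (borel M)) : i != j -> measurable B -> measurable C ->
    P (Xs i @^-1` B `&` Xs j @^-1` C) = (P (Xs i @^-1` B) * P (Xs j @^-1` C))%E.
  move=> ij mB mC.
  pose D k := if k == i then B else C.
  have := Xind [:: i; j] D; rewrite /= inE ij => /(_ isT).
  rewrite big_cons big_seq1 /D eqxx eq_sym (negbTE ij) => <-; last first.
    by move=> k; case: ifP.
  congr (P _); apply/seteqP; split=> [w [wi wj] k /=|w H].
    by rewrite !inE => /orP[] /eqP ->; rewrite ?eqxx// eq_sym (negbTE ij).
  split.
    by have := H i; rewrite /= inE eqxx; apply.
  by have := H j; rewrite /= !inE eqxx orbT eq_sym (negbTE ij); apply.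
have [y0 [C [_ PC coer]]] := coercive.
have Zoo : (\int[P]_w (- ln (p (X w) z t) + ln b)%R%:E < +oo)%E.
  apply: integral_shift_lty.
  - by apply: (measurableT_comp (mp z)).
  - by move=> w; rewrite -lerBlDr sub0r.
  - by move: Ez; rewrite unlock ltey.
have [||a az] := @eventually_average_le _ _ _ P _ _ X Xs Xid Xs_ind
  (fun x => - ln (p x z t) + ln b) _ _ Zoo.
- by apply: measurable_funD.
- by move=> x; rewrite -lerBlDr sub0r.
have [|c c0 cK] := @eventually_frequency_ge _ _ _ P _ _ X Xs Xid Xs_ind
  [set x | - ln (p x y0 t) < C] _ PC.
  rewrite (_ : [set x | _] = ~` [set x | C <= - ln (p x y0 t)]); last first.
    by apply/seteqP; split=> x /=; rewrite ltNge => /negP.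
  by apply: measurableC; exact: (measurable_set_ge (Omega := borel M)).
apply: filterS3 az cK (filterI ziezold heine_borel) => w [n1 w1] [n2 w2] [w3 w4].
apply: (@tail_union_sub_ball_around _ _ _ _ _ _ _ _ _ _ y0) => //.
exact: (estimator_no_escape pL coer c0 w1 w2).
Qed.
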